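(* Let $\Omega$ be decomposed into two nonoverlapping subdomains $\Omega_1,\Omega_2$ symmetric with respect to their common interface $\Gamma$ (symmetric case), with coefficients $\nu_1,\nu_2>0$. Let $c_0,C_1>0$ be constants independent of $h$ such that every eigenvalue of $S_1/\nu_1=S_2/\nu_2$ lies in $[c_0,C_1h^{-1}]$. Then there is a constant $C>0$ independent of $h,\nu_1,\nu_2$ such that, if $\gamma_1\ge C_1\nu_2h^{-1}$, $0<\gamma_2\le c_0\nu_1$ and $\theta=\frac{2}{2+\nu_1/\nu_2}$, the convergence rate of the Robin-Robin algorithm with Robin parameters $\gamma_1,\gamma_2$ and relaxation parameter $\theta$ satisfies $$\rho(R_4)\le C\,\frac{\nu_1}{\nu_2},$$ where $R_4$ is the error operator of the algorithm and $\rho$ denotes spectral radius.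
   Context: Setting: $\Omega\subset\mathbb{R}^2$ is a bounded polygonal domain, divided into nonoverlapping subdomains $\Omega_1,\Omega_2$ with interface $\Gamma=\partial\Omega_1\cap\partial\Omega_2$. The problem is $-\nabla\cdot(\nu\nabla u)=f$ in $\Omega$, $u=0$ on $\partial\Omega$, with $\nu=\nu_i>0$ constant on $\Omega_i$. $\mathcal{T}_h$ is a quasi-uniform regular triangulation of $\Omega$ of mesh size $h$, with $\Gamma$ not cutting any element. $W\subset H_0^1(\Omega)$ is the P1 conforming finite element space; $W_i$ is the space of restrictions of functions in $W$ to $\Omega_i$; $W_i^0\subset W_i$ is the subspace of functions vanishing on $\partial\Omega_i$; $V_\Gamma=W|_\Gamma$. Put $a_i(u,v)=\int_{\Omega_i}\nu_i\nabla u\cdot\nabla v$, $(f,v)_i=\int_{\Omega_i}fv$ and $\langle u,v\rangle=\int_\Gamma uv$. The discrete harmonic extension $\mathcal{H}_i:V_\Gamma\to W_i$ is defined by $a_i(\mathcal{H}_iu_\Gamma,v)=0$ for all $v\in W_i^0$, $\mathcal{H}_iu_\Gamma=u_\Gamma$ on $\Gamma$, $\mathcal{H}_iu_\Gamma=0$ on $\partial\Omega_i\setminus\Gamma$. The operator $S_i:V_\Gamma\to V_\Gamma$ is defined by $\langle S_iu_\Gamma,v_\Gamma\rangle=a_i(\mathcal{H}_iu_\Gamma,T_iv_\Gamma)$ for all $v_\Gamma\in V_\Gamma$, where $T_i:V_\Gamma\to W_i$ is any extension operator; $S_i$ is symmetric positive definite. Symmetric case: $\Omega_1$ and $\Omega_2$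 (together with their triangulations) are mirror images of each other with respect to $\Gamma$, so that $S_1/\nu_1=S_2/\nu_2$. Robin-Robin algorithm (parameters $\gamma_1,\gamma_2>0$, relaxation $\theta$): from $g_1^n\in V_\Gamma$, find $u_1^n\in W_1$ with $a_1(u_1^n,v)+\gamma_1\langle u_1^n,v\rangle=(f,v)_1+\langle g_1^n,v\rangle$ for all $v\in W_1$; set $g_2^n=(\gamma_1+\gamma_2)u_1^n-g_1^n$ on $\Gamma$; find $u_2^n\in W_2$ with $a_2(u_2^n,v)+\gamma_2\langle u_2^n,v\rangle=(f,v)_2+\langle g_2^n,v\rangle$ for all $v\in W_2$; set $\tilde g_1^n=(\gamma_1+\gamma_2)u_2^n-g_2^n$ on $\Gamma$ and $g_1^{n+1}=\theta\tilde g_1^n+(1-\theta)g_1^n$. The error in $g_1^n$ is propagated by the error operator $$R_4=I-\theta\left(I-(\gamma_1I-S_2)(\gamma_2I+S_2)^{-1}(\gamma_2I-S_1)(\gamma_1I+S_1)^{-1}\right)$$ on $V_\Gamma$. The convergence rate of the algorithm is the spectral radius of $R_4$. *)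

(* Defs.v *)
From HB Require Import structures.
From mathcomp Require Import all_boot all_order all_algebra.
From mathcomp Require Import all_classical all_reals all_analysis.
From mathcomp Require Import complex.

Set Implicit Arguments.
Unset Strict Implicit.
Unset Printing Implicit Defensive.

Import Order.TTheory GRing.Theory Num.Theory.
Import numFieldNormedType.Exports.

Local Open Scope classical_set_scope.
Local Open Scope ring_scope.

(* The topology and Lebesgue measure of R^2 are the product ones on R * R.  The
   library norm of R * R is the sup norm, hence the explicit Euclidean distance
   and inner product. *)
Section Plane.
Context {R : realType}.
Local Notation pt := (R * R)%type.

Definition dot (x y : pt) : R := x.1 * y.1 + x.2 * y.2.

Definition edist (x y : pt) : R := Num.sqrt (dot (x - y) (x - y)).

Definition diam (A : set pt) : R := sup [set edist z.1 z.2 | z in A `*` A].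

Definition boundary (A : set pt) : set pt := closure A `\` interior A.

Definition closed_segment (a b : pt) : set pt :=
  [set (1 - t) *: a + t *: b | t in `[0, 1]].

Definition domain (A : set pt) : Prop := [/\ open A, connected A & A !=set0].

Definition polygonal_domain (A : set pt) : Prop :=
  [/\ domain A, bounded_set A &
      exists s : seq (pt * pt),
        boundary A = [set x | exists2 e, e \in s & closed_segment e.1 e.2 x]].

Definition interface (Omega1 Omega2 : set pt) : set pt :=
  boundary Omega1 `&` boundary Omega2.

Definition decomposition (Omega Omega1 Omega2 : set pt) : Prop :=
  [/\ domain Omega1, domain Omega2, Omega1 `&` Omega2 = set0 &
      Omega1 `|` Omega2 = Omega `\` interface Omega1 Omega2].

(* Reflection across the line through p with unit normal n. *)
Definition reflection (p n : pt) (x : pt) : pt :=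
  x - (2 * dot (x - p) n) *: n.

Definition mirror_domains (p n : pt) (Omega1 Omega2 : set pt) : Prop :=
  [/\ dot n n = 1,
      (forall x, interface Omega1 Omega2 x -> dot (x - p) n = 0) &
      reflection p n @` Omega1 = Omega2].

End Plane.

Record mesh (R : realType) := Mesh {
  nb_nodes : nat;
  node : 'I_nb_nodes -> R * R;
  tris : {set {set 'I_nb_nodes}}
}.

Section Meshes.
Context {R : realType}.
Implicit Types (M : mesh R) (Omega : set (R * R)).

(* Closed convex hull of a set of nodes (empty for the empty set of nodes). *)
Definition cell M (A : {set 'I_(nb_nodes M)}) : set (R * R) :=
  [set x | exists l : 'I_(nb_nodes M) -> R,
     [/\ forall i, 0 <= l i, forall i, i \notin A -> l i = 0,
         \sum_i l i = 1 & x = \sum_i l i *: node i]].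

(* Besides covering and nondegeneracy, the last clause is conformity: two
   triangles meet exactly in the convex hull of their common vertices. *)
Definition triangulation Omega M : Prop :=
  [/\ injective (@node R M),
      \bigcup_(T in [set` tris M]) cell T = closure Omega,
      (forall T, T \in tris M ->
         [/\ #|T| = 3%N, interior (cell T) !=set0
           & interior (cell T) `<=` Omega]) &
      (forall T T', T \in tris M -> T' \in tris M ->
         cell T `&` cell T' = cell (T :&: T'))].

Definition cuts_no_element (Gamma : set (R * R)) M : Prop :=
  forall T, T \in tris M -> interior (cell T) `&` Gamma = set0.

Definition mirror_mesh (p n : R * R) M : Prop :=
  forall T, T \in tris M ->
    exists2 T', T' \in tris M & cell T' = reflection p n @` cell T.

Definition mesh_h M : R := \big[Num.max/0]_(T in tris M) diam (cell T).

Definition shape_regular (I : Type) (M : I -> mesh R) : Prop :=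
  exists2 sigma : R, 0 < sigma &
    forall k T, T \in tris (M k) ->
      exists x r, [/\ 0 < r, [set y | edist x y <= r] `<=` cell T
                    & diam (cell T) <= sigma * r].

Definition quasi_uniform (I : Type) (M : I -> mesh R) : Prop :=
  exists2 tau : R, 0 < tau &
    forall k T, T \in tris (M k) -> mesh_h (M k) <= tau * diam (cell T).

End Meshes.

(* A function on a subset of the plane is represented by its extension by zero,
   so that a finite-dimensional function space is a set of maps R * R -> R. *)
Section FiniteElements.
Context {R : realType}.
Local Notation fct := (R * R -> R).
Variables (M : mesh R) (Omega Omega1 Omega2 : set (R * R)).
Implicit Types (D : set (R * R)) (u v w s : fct).

Local Notation Gamma := (interface Omega1 Omega2).

Definition affine_on (A : set (R * R)) w : Prop :=
  exists a b c : R, forall x, A x -> w x = a + b * x.1 + c * x.2.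

(* Vanishing off the open set Omega is the zero boundary condition together
   with the extension by zero. *)
Definition W : set fct :=
  [set w | [/\ continuous w, (forall x, ~ Omega x -> w x = 0) &
               forall T, T \in tris M -> affine_on (cell T) w]].

(* Restrictions are taken on the closure of the subdomain D, so that traces on
   its boundary are values. *)
Definition Wsub D : set fct := [set w \_ (closure D) | w in W].

Definition Wsub0 D : set fct :=
  [set v | Wsub D v /\ forall x, boundary D x -> v x = 0].

Definition VGamma : set fct := [set w \_ Gamma | w in W].

Definition grad u (x : R * R) : R * R := ('D_(1, 0) u x, 'D_(0, 1) u x).

Definition aform D (nu : R) u v : R :=
  \int[(@lebesgue_measure R \x @lebesgue_measure R)%E]_(x in D)
    (nu * dot (grad u x) (grad v x)).

Definition edge_integral (a b : R * R) (g : fct) : R :=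
  edist a b *
    \int[@lebesgue_measure R]_(t in `[0, 1]) g ((1 - t) *: a + t *: b).

Definition interface_edge (i j : 'I_(nb_nodes M)) : Prop :=
  (exists2 T, T \in tris M & [set i; j] \subset T) /\
  cell [set i; j] `<=` Gamma.

(* Arc-length integral over Gamma of the product u v; the triangulation being
   conforming, Gamma is made of edges of the mesh.  The condition i < j counts
   each edge once. *)
Definition ip_Gamma u v : R :=
  \sum_(i < nb_nodes M) \sum_(j < nb_nodes M |
      (i < j)%N && `[< interface_edge i j >])
    edge_integral (node i) (node j) (fun x => u x * v x).

Definition harmonic_extension_spec D (nu : R) u w : Prop :=
  [/\ Wsub D w,
      (forall v, Wsub0 D v -> aform D nu w v = 0),
      (forall x, Gamma x -> w x = u x) &
      (forall x, (boundary D `\` Gamma) x -> w x = 0)].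

Definition harmonic_extension D (nu : R) u : fct :=
  xget 0 [set w | harmonic_extension_spec D nu u w].

Definition extension_operator D (E : fct -> fct) : Prop :=
  forall v, VGamma v -> Wsub D (E v) /\ forall x, Gamma x -> E v x = v x.

(* Value at u of the operator S attached to the subdomain D with coefficient
   nu. *)
Definition schur D (nu : R) u : fct :=
  xget 0 [set s | VGamma s /\
    forall E, extension_operator D E -> forall v, VGamma v ->
      ip_Gamma s v = aform D nu (harmonic_extension D nu u) (E v)].

End FiniteElements.

Section Operators.
Context {R : realType}.
Local Notation fct := (R * R -> R).
Implicit Types (V : set fct) (A : fct -> fct).

(* Eigenvalues on the complexification of V: the eigenvector is x + i y. *)
Definition op_eigenvalue V A (z : R[i]) : Prop :=
  exists x y, [/\ V x, V y, ~ (x = 0 /\ y = 0),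
    A x = complex.Re z *: x - complex.Im z *: y &
    A y = complex.Im z *: x + complex.Re z *: y].

(* V is finite dimensional in all uses, so the set of moduli is finite; it is
   empty, with supremum 0, exactly when V is trivial. *)
Definition spectral_radius V A : R :=
  sup [set ComplexField.Normc.normc z | z in op_eigenvalue V A].

Definition op_inv V A : fct -> fct := 'pinv_(fun=> 0) V A.

Definition error_operator V (S1 S2 : fct -> fct) (gamma1 gamma2 theta : R) :
    fct -> fct :=
  let plus gamma (S : fct -> fct) := fun u : fct => gamma *: u + S u in
  let minus gamma (S : fct -> fct) := fun u : fct => gamma *: u - S u in
  let K := minus gamma1 S2 \o op_inv V (plus gamma2 S2)
             \o minus gamma2 S1 \o op_inv V (plus gamma1 S1) in
  fun u : fct => u - theta *: (u - K u).

Definition robin_robin_rate (M : mesh R) (Omega Omega1 Omega2 : set (R * R))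
    (nu1 nu2 gamma1 gamma2 theta : R) : R :=
  spectral_radius (VGamma M Omega Omega1 Omega2)
    (error_operator (VGamma M Omega Omega1 Omega2)
       (schur M Omega Omega1 Omega2 Omega1 nu1)
       (schur M Omega Omega1 Omega2 Omega2 nu2)
       gamma1 gamma2 theta).

End Operators.

(* Main.v *)
Require Import Defs.
From HB Require Import structures.
From mathcomp Require Import all_boot all_order all_algebra.
From mathcomp Require Import all_classical all_reals all_analysis.
From mathcomp Require Import complex.
From mathcomp Require Import measurable_realfun.
From mathcomp Require Import ring lra.

Set Implicit Arguments.
Unset Strict Implicit.
Unset Printing Implicit Defensive.

Import Order.TTheory GRing.Theory Num.Theory.
Import numFieldNormedType.Exports.

Local Open Scope classical_set_scope.
Local Open Scope ring_scope.

(* Write S for the common operator S_1 / nu_1 = S_2 / nu_2, self-adjoint and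
   with spectrum in [c_0, C_1 / h].  Then R_4 is a rational function of S, hence
   self-adjoint, so its eigenvalues are real, and each of them is the value at
   some eigenvalue t of S of
     1 - theta (1 + k),
     k = (gamma_1 - nu_2 t) (nu_1 t - gamma_2)
           / ((gamma_2 + nu_2 t) (gamma_1 + nu_1 t)).
   The conditions on the parameters give 0 <= k <= r := nu_1 / nu_2, and
   theta = 2 / (2 + r) maps this range into [- r / (2 + r), r / (2 + r)].
   No spectral theorem is used: an eigenvector of R_4 is annihilated by a real
   quadratic polynomial in S, which splits because S is self-adjoint.

   That S_1 and S_2 exist is extracted from the bound on the eigenvalues: where
   the definition of the Schur operator falls back on its default value 0, it
   would have the eigenvalue 0 < c_0.  Uniqueness follows from Cauchy-Schwarz
   for the energy forms, and from the definiteness of the product on the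
   interface, since the mesh edges contained in the line of symmetry are dense
   in the part of the interface inside the domain.  The equality S_1 / nu_1 = S_2 / nu_2
   comes from the invariance of the Lebesgue measure of the plane under the
   reflection, which is a composition of shears up to an axis reflection. *)

(** * Self-adjoint operators on function spaces *)

Section Subspaces.
Variables (R : realType) (T : Type).
Local Notation E := (T -> R).
Variable V : set E.
Implicit Types (u v w : E) (A : E -> E).

Definition subspace := V 0 /\ forall a u v, V u -> V v -> V (a *: u + v).

Definition linear_on A :=
  (forall u, V u -> V (A u)) /\
  forall a u v, V u -> V v -> A (a *: u + v) = a *: A u + A v.

Definition scalar_product (ip : E -> E -> R) :=
  [/\ forall a u v w, V u -> V v -> V w ->
        ip (a *: u + v) w = a * ip u w + ip v w,
      forall u v, ip u v = ip v u &
      forall u, V u -> u <> 0 -> 0 < ip u u].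

Definition self_adjoint (ip : E -> E -> R) A :=
  forall u v, V u -> V v -> ip (A u) v = ip u (A v).

(** Finite dimension is linear dependence of any [N.+1] vectors, a form that applies directly to the
    iterates of an operator and needs no basis. *)
Definition dimension_le (N : nat) :=
  forall f : nat -> E, (forall i, V (f i)) ->
    exists c : nat -> R, (exists2 i, (i < N.+1)%N & c i != 0) /\
      \sum_(i < N.+1) c i *: f i = 0.

Hypothesis sV : subspace.

Lemma subspaceZ a u : V u -> V (a *: u).
Proof. by move=> Vu; rewrite -[_ *: _]addr0; apply: sV.2 => //; exact: sV.1. Qed.

Lemma subspaceD u v : V u -> V v -> V (u + v).
Proof. by move=> Vu Vv; rewrite -[u]scale1r; apply: sV.2. Qed.

Lemma subspaceN u : V u -> V (- u).
Proof. by rewrite -scaleN1r; exact: subspaceZ. Qed.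

Lemma subspaceB u v : V u -> V v -> V (u - v).
Proof. by move=> Vu Vv; apply: subspaceD => //; exact: subspaceN. Qed.

Lemma subspace_sum n (f : 'I_n -> E) : (forall i, V (f i)) -> V (\sum_i f i).
Proof. by move=> Vf; apply: big_ind => //; [exact: sV.1 | exact: subspaceD]. Qed.

Section LinearOn.
Variable A : E -> E.
Hypothesis lA : linear_on A.

Lemma linear_onD u v : V u -> V v -> A (u + v) = A u + A v.
Proof. by move=> Vu Vv; rewrite -{1}[u]scale1r lA.2// scale1r. Qed.

Lemma linear_on0 : A 0 = 0.
Proof.
have := linear_onD sV.1 sV.1; rewrite addr0 => /eqP.
by rewrite -subr_eq0 opprD addrA subrr sub0r oppr_eq0 => /eqP.
Qed.

Lemma linear_onZ a u : V u -> A (a *: u) = a *: A u.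
Proof.
by move=> Vu; rewrite -[_ *: u]addr0 lA.2// ?linear_on0 ?addr0//; exact: sV.1.
Qed.

Lemma linear_on_lincomb n (c : nat -> R) (f : nat -> E) : (forall i, V (f i)) ->
  A (\sum_(i < n) c i *: f i) = \sum_(i < n) c i *: A (f i).
Proof.
move=> Vf; elim: n => [|n ih]; first by rewrite !big_ord0 linear_on0.
rewrite !big_ord_recr /= linear_onD ?ih ?linear_onZ//.
  by apply: subspace_sum => i; exact: subspaceZ.
exact: subspaceZ.
Qed.

(* A nontrivial relation between the iterates of [u] can be divided by [A]
   until its constant coefficient is nonzero. *)
Lemma inj_surj_on N : dimension_le N ->
  (forall u, V u -> A u = 0 -> u = 0) ->
  forall u, V u -> exists2 v, V v & A v = u.
Proof.
move=> dV injA u Vu.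
have Vi i : V (iter i A u) by elim: i => //= i; exact: lA.1.
have [c [ex0]] := dV _ Vi.
elim: {dV}N.+1 c ex0 => [|m ih] c [i im ci0]; first by [].
rewrite big_ord_recl/=; set s := \sum_(_ < _) _ => c0s.
have sE : s = A (\sum_(k < m) c k.+1 *: iter k A u).
  by rewrite (linear_on_lincomb _ (fun k => c k.+1) Vi).
have Vs : V (\sum_(k < m) c k.+1 *: iter k A u).
  by apply: subspace_sum => k; exact: subspaceZ.
have [c00|c00] := eqVneq (c 0%N) 0.
  apply: (ih (fun k => c k.+1)).
    by case: i im ci0 => [|i]; [rewrite c00 eqxx|move=> im ci0; exists i].
  by apply: injA => //; rewrite -sE -c0s c00 scale0r add0r.
exists (- (c 0%N)^-1 *: \sum_(k < m) c k.+1 *: iter k A u); first exact: subspaceZ.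
rewrite linear_onZ// -sE; move/eqP: c0s; rewrite addrC addr_eq0 => /eqP ->.
by rewrite scalerN scaleNr opprK scalerA mulVf// scale1r.
Qed.

End LinearOn.

Section SelfAdjoint.
Variables (ip : E -> E -> R).
Hypothesis ipP : scalar_product ip.

Lemma ipDl u v w : V u -> V v -> V w -> ip (u + v) w = ip u w + ip v w.
Proof.
by case: ipP => l _ _ Vu Vv Vw; rewrite -[u in LHS]scale1r l// mul1r.
Qed.

Lemma ip0l w : V w -> ip 0 w = 0.
Proof.
move=> Vw; have /eqP := ipDl sV.1 sV.1 Vw; rewrite addr0.
by rewrite -subr_eq0 opprD addrA subrr sub0r oppr_eq0 => /eqP.
Qed.

Lemma ipZl a u w : V u -> V w -> ip (a *: u) w = a * ip u w.
Proof.
case: ipP => l _ _ Vu Vw; rewrite -[_ *: u in LHS]addr0 l ?ip0l ?addr0//.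
exact: sV.1.
Qed.

Lemma ipDr u v w : V u -> V v -> V w -> ip w (u + v) = ip w u + ip w v.
Proof. by case: ipP => _ c _ *; rewrite c ipDl// !(c w). Qed.

Lemma ipZr a u w : V u -> V w -> ip w (a *: u) = a * ip w u.
Proof. by case: ipP => _ c _ *; rewrite c ipZl// (c w). Qed.

Lemma ip_ge0 u : V u -> 0 <= ip u u.
Proof.
case: ipP => _ _ p Vu; have [->|u0] := eqVneq u 0; last first.
  by apply/ltW/p => //; exact/eqP.
by rewrite ip0l//; exact: sV.1.
Qed.

Lemma ip_eq0 u : V u -> ip u u = 0 -> u = 0.
Proof.
case: ipP => _ _ p Vu u0; apply: contrapT => /(p _ Vu).
by rewrite u0 ltxx.
Qed.

Variable S : E -> E.
Hypotheses (lS : linear_on S) (sS : self_adjoint ip S).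

(* With [e := (S - t) d] and [t] the abscissa of the vertex, self-adjointness
   gives |e|^2 = - delta |d|^2, so the discriminant of the quadratic is
   nonnegative and the quadratic splits over R. *)
Lemma quadratic_eigenvector (a b c : R) d : V d -> d <> 0 ->
  a *: S (S d) + b *: S d + c *: d = 0 -> (a != 0) || (b != 0) ->
  exists lambda v,
    [/\ V v, v <> 0, S v = lambda *: v & a * lambda ^+ 2 + b * lambda + c = 0].
Proof.
move=> Vd d0 abc ab0.
have VS u : V u -> V (S u) by exact: lS.1.
have [a0|a0] := eqVneq a 0.
  move: ab0 abc; rewrite a0 eqxx/= scale0r add0r => b0 bc.
  exists (- (c / b)), d; split => //; last by field.
  move/eqP: bc; rewrite addr_eq0 => /eqP bc.
  apply: (scalerI b0); rewrite bc scalerA -scaleNr; congr (_ *: _).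
  by field.
pose t := - (b / (2 * a)); pose delta := c / a - t ^+ 2.
pose e := S d - t *: d.
have Ve : V e by apply: subspaceB; [exact: VS|exact: subspaceZ].
have SSd : S (S d) = - (b / a) *: S d - (c / a) *: d.
  apply/funext => x.
  have abcx : a * S (S d) x + b * S d x + c * d x = 0 := congr1 (@^~ x) abc.
  rewrite !fctE /GRing.scale /=; apply: (mulfI a0); apply/eqP; rewrite -subr_eq0.
  by rewrite -abcx; apply/eqP; field.
have Se : S e = t *: e - delta *: d.
  rewrite /e linear_onD//; [|exact: VS|by apply: subspaceN; exact: subspaceZ].
  rewrite -scaleNr linear_onZ// SSd; apply/funext => x; rewrite !fctE /GRing.scale /=.
  by rewrite /delta /t; field.
have ee : ip e e = - delta * ip d d.
  have VSd := VS _ Vd; have VSe := VS _ Ve.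
  rewrite {1}/e ipDl ?sS -?scaleNr ?ipZl//; last exact: subspaceZ.
  rewrite Se ipDr -?scaleNr ?ipZr//; [|exact: subspaceZ..].
  ring.
have delta0 : delta <= 0.
  rewrite -oppr_ge0 -(@pmulr_lge0 _ (ip d d)) -?ee ?ip_ge0//.
  by case: ipP => _ _; apply.
pose s := Num.sqrt (- delta).
have s2 : s ^+ 2 = - delta by rewrite sqr_sqrtr// oppr_ge0.
have root l : (l = t + s \/ l = t - s) -> a * l ^+ 2 + b * l + c = 0.
  have -> : c = a * (delta + t ^+ 2) by rewrite /delta; field.
  have -> : b = - (2 * a * t) by rewrite /t; field.
  have -> : delta = - s ^+ 2 by rewrite s2 opprK.
  by case=> ->; ring.
have [f0|f0] := eqVneq (e + s *: d) 0.
  exists (t - s), d; split => //; last by apply: root; right.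
  apply/funext => x.
  have f0x : S d x - t * d x + s * d x = 0 := congr1 (@^~ x) f0.
  by rewrite !fctE /GRing.scale /=; apply/eqP; rewrite -subr_eq0 -f0x; apply/eqP; ring.
have Vsd : V (s *: d) by exact: subspaceZ.
exists (t + s), (e + s *: d); split; [exact: subspaceD|exact/eqP| |by apply: root; left].
rewrite linear_onD// linear_onZ// Se.
apply/funext => x; rewrite /e !fctE /GRing.scale /=.
have -> : delta = - s ^+ 2 by rewrite s2 opprK.
ring.
Qed.

End SelfAdjoint.
End Subspaces.

(** * Spectrum of the error operator *)

Section RobinRobin.
Variables (R : realType).
Local Notation fct := (R * R -> R).
Variables (V : set fct) (ip : fct -> fct -> R) (S S1 S2 : fct -> fct).
Variables (N : nat) (c0 K nu1 nu2 gamma1 gamma2 : R).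
Hypotheses (sV : subspace V) (dV : dimension_le V N).
Hypotheses (ipP : scalar_product V ip).
Hypotheses (lS : linear_on V S) (sS : self_adjoint V ip S).
Hypotheses (c0_gt0 : 0 < c0).
Hypothesis spS : forall lambda : R, op_eigenvalue V S lambda%:C%C ->
  c0 <= lambda <= K.
Hypotheses (S1E : forall u, V u -> S1 u = nu1 *: S u)
  (S2E : forall u, V u -> S2 u = nu2 *: S u).
Hypotheses (nu1_gt0 : 0 < nu1) (nu2_gt0 : 0 < nu2) (gamma2_gt0 : 0 < gamma2).
Hypotheses (K_ge0 : 0 <= K) (gamma1_ge : nu2 * K <= gamma1) (gamma2_le : gamma2 <= c0 * nu1).

(** A real eigenvector becomes an eigenvector of the complexification with zero imaginary part, so
    the spectral bound applies to it. *)
Lemma real_eigenvalue lambda u : V u -> u <> 0 -> S u = lambda *: u ->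
  c0 <= lambda <= K.
Proof.
move=> Vu u0 Su; apply: spS; exists u, 0; split => //=.
- exact: sV.1.
- by case.
- by rewrite scale0r subr0.
- by rewrite (linear_on0 sV lS) scale0r add0r scaler0.
Qed.

Let VS u : V u -> V (S u). Proof. exact: lS.1. Qed.

(** A nonzero kernel vector would be an eigenvector of [S] for [- (gamma / nu)], which must be at
    least [c0 > 0]. In the second alternative the sign of [gamma] comes from that eigenvalue itself:
    it forces [K > 0], hence [gamma > 0]. *)
Lemma shift_inj gamma nu u : 0 < nu -> 0 < gamma \/ nu2 * K <= gamma -> V u ->
  gamma *: u + nu *: S u = 0 -> u = 0.
Proof.
move=> nu0 gamma0 Vu u0; apply: contrapT => un0.
have /(real_eigenvalue Vu un0)/andP[h1 h2] : S u = (- (gamma / nu)) *: u.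
  apply/funext => x; rewrite !fctE /GRing.scale /=.
  have ux : gamma * u x + nu * S u x = 0 := congr1 (@^~ x) u0.
  apply: (mulfI (lt0r_neq0 nu0)); apply/eqP; rewrite -subr_eq0 -ux.
  by apply/eqP; field; exact: lt0r_neq0.
have : 0 < gamma.
  case: gamma0 => // ?; apply: lt_le_trans; last eassumption.
  by apply: mulr_gt0 => //; apply: lt_le_trans (le_trans h1 h2).
move=> g0; have : 0 < gamma / nu by exact: divr_gt0.
by move=> h; have := lt_le_trans c0_gt0 h1; rewrite oppr_gt0 ltNge ltW.
Qed.

Lemma shift_linear gamma nu : linear_on V (fun u => gamma *: u + nu *: S u).
Proof.
split=> [u Vu|a u v Vu Vv].
  by apply: subspaceD => //; apply: subspaceZ => //; exact: VS.
by rewrite lS.2//; apply/funext => x; rewrite !fctE /GRing.scale /=; ring.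
Qed.

(** The partial inverse is a true inverse on [V]: the shifted operator is injective there, hence
    onto by finite dimension. *)
Lemma op_inv_shift gamma nu (S' : fct -> fct) u : 0 < nu ->
    0 < gamma \/ nu2 * K <= gamma -> (forall v, V v -> S' v = nu *: S v) -> V u ->
  let w := op_inv V (fun v => gamma *: v + S' v) u in
  V w /\ gamma *: w + nu *: S w = u.
Proof.
move=> nu0 gamma0 S'E Vu w.
pose A v : fct := gamma *: v + S' v.
have AE v : V v -> A v = gamma *: v + nu *: S v by move=> Vv; rewrite /A S'E.
have [v Vv Av] : exists2 v, V v & gamma *: v + nu *: S v = u.
  apply: (inj_surj_on sV (shift_linear gamma nu) dV) => // v Vv.
  exact: shift_inj.
have wv : w = v.
  rewrite /w -Av -AE//; apply: pinvKV; last exact: mem_set.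
  move=> v1 v2 /set_mem Vv1 /set_mem Vv2; rewrite -/(A v1) -/(A v2) !AE// => v12.
  apply/eqP; rewrite -subr_eq0; apply/eqP/(@shift_inj gamma nu) => //.
    exact: subspaceB.
  have SB : S (v1 - v2) = S v1 - S v2.
    rewrite (linear_onD lS)//; last exact: subspaceN.
    by rewrite -scaleN1r (linear_onZ sV lS)// scaleN1r.
  rewrite SB; apply/funext => x.
  have := congr1 (@^~ x) v12; rewrite !fctE /GRing.scale /= => v12x.
  by apply: (etrans _ (subrr (gamma * v2 x + nu * S v2 x))); rewrite -{1}v12x; ring.
by rewrite wv.
Qed.

Variable theta : R.
Let b := gamma1 * nu1 + gamma2 * nu2 + gamma1 * nu2 + gamma2 * nu1.
Let Q (d : fct) : fct :=
  (gamma1 * gamma2) *: d + (gamma1 * nu2 + gamma2 * nu1) *: S d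
  + (nu1 * nu2) *: S (S d).

(* With [u = (gamma1 + S1) (gamma2 + S2) d], the error operator reads
   [u - theta b S d], since the two quadratics in S differ by [b S]. *)
Lemma error_operatorE u : V u -> exists2 d, V d &
  u = Q d /\
  (error_operator V S1 S2 gamma1 gamma2 theta u = Q d - (theta * b) *: S d).
Proof.
move=> Vu; rewrite /error_operator /=.
have /= [] := op_inv_shift nu1_gt0 (or_intror gamma1_ge) S1E Vu.
set w := op_inv _ _ u => Vw wE.
have /= [] := op_inv_shift nu2_gt0 (or_introl gamma2_gt0) S2E Vw.
set d := op_inv _ _ w => Vd dE.
have Vw2 : V (gamma2 *: w - S1 w).
  by rewrite S1E//; apply: subspaceB => //; apply: subspaceZ => //; exact: VS.
have /= [] := op_inv_shift nu2_gt0 (or_introl gamma2_gt0) S2E Vw2.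
set c := op_inv _ _ (_ - _) => Vc cE.
have Sw : S w = gamma2 *: S d + nu2 *: S (S d).
  rewrite -dE lS.2 ?(linear_onZ sV lS)//; first exact: VS.
  by apply: subspaceZ => //; exact: VS.
have Sw' a1 a2 : S (a1 *: d + a2 *: S d) = a1 *: S d + a2 *: S (S d).
  rewrite lS.2 ?(linear_onZ sV lS)//; first exact: VS.
  by apply: subspaceZ => //; exact: VS.
(* Polynomials in [S] commute, so [gamma2 - S1] can be moved past the inverse of [gamma2 + S2]; both
   candidates have the same image under the injective shift. *)
have cd : c = gamma2 *: d + (- nu1) *: S d.
  apply/eqP; rewrite -subr_eq0; apply/eqP.
  have Vd' : V (gamma2 *: d + - nu1 *: S d).
    by apply: sV.2 => //; apply: subspaceZ => //; exact: VS.
  apply: (@shift_inj gamma2 nu2) => //; [by left|exact: subspaceB|].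
  rewrite (linear_onD lS)//; last exact: subspaceN.
  rewrite -[in S (- _)]scaleN1r (linear_onZ sV lS)// Sw'.
  apply/funext => x; have := congr1 (@^~ x) cE.
  have := congr1 (@^~ x) dE; have := congr1 (@^~ x) Sw.
  rewrite S1E// !fctE /GRing.scale /= => -> <- cx.
  by apply: (etrans _ (subrr (gamma2 * c x + nu2 * S c x))); rewrite {2}cx; ring.
have uE : u = Q d.
  rewrite -wE Sw -[in gamma1 *: w]dE /Q.
  by apply/funext => x; rewrite !fctE /GRing.scale /=; ring.
exists d => //; split=> //.
rewrite -uE S2E// cd Sw' {2}uE /Q /b.
by apply/funext => x; rewrite !fctE /GRing.scale /=; ring.
Qed.

Lemma Q_mem d : V d -> V (Q d).
Proof.
move=> Vd; have VSd := VS Vd; have VSSd := VS VSd.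
by apply: subspaceD => //; [apply: subspaceD => //|]; exact: subspaceZ.
Qed.

(** With [u = Q d] and [v = Q e], the claim reduces to the symmetry of the product of [S d] with
    [Q e], which holds because [Q] is a polynomial in the self-adjoint [S]. *)
Lemma error_operator_self_adjoint :
  self_adjoint V ip (error_operator V S1 S2 gamma1 gamma2 theta).
Proof.
move=> u v Vu Vv.
have [d Vd [uE ->]] := error_operatorE Vu.
have [e Ve [vE ->]] := error_operatorE Vv.
have VQd := Q_mem Vd; have VQe := Q_mem Ve.
have VSd := VS Vd; have VSe := VS Ve.
have VSSd := VS VSd; have VSSe := VS VSe.
have VZd a := subspaceZ sV a VSd; have VZe a := subspaceZ sV a VSe.
rewrite -!scaleNr (ipDl ipP)// (ipDr ipP)// -?uE -?vE; congr (_ + _).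
rewrite (ipZl sV ipP)// (ipZr sV ipP)//; congr (_ * _).
rewrite uE vE /Q.
have D a w : V w -> V (a *: w) by exact: subspaceZ.
rewrite !(ipDl ipP) ?(ipDr ipP)//; [|by do ?[apply: subspaceD => //]; exact: D..].
rewrite !(ipZl sV ipP)// !(ipZr sV ipP)//.
by rewrite (sS Vd Ve) (sS VSd VSe).
Qed.

Lemma error_operator_eigenvalue_bound z : theta = 2 / (2 + nu1 / nu2) ->
  op_eigenvalue V (error_operator V S1 S2 gamma1 gamma2 theta) z ->
  ComplexField.Normc.normc z <= nu1 / nu2.
Proof.
move=> thetaE [x [y [Vx Vy xy Ax Ay]]].
have r0 : 0 < nu1 / nu2 by exact: divr_gt0.
set a := complex.Re z in Ax Ay; set i := complex.Im z in Ax Ay.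
(* Comparing the product of [A x] with [y] and of [x] with [A y] leaves
   [i * (ip x x + ip y y) = 0]. *)
have i0 : i = 0.
  have := error_operator_self_adjoint Vx Vy; rewrite Ax Ay -scaleNr.
  have Vz := subspaceZ sV.
  rewrite (ipDl ipP) ?(ipDr ipP)//; [|exact: Vz..].
  rewrite !(ipZl sV ipP)// !(ipZr sV ipP)// => h.
  have x0 := ip_ge0 sV ipP Vx; have y0 := ip_ge0 sV ipP Vy.
  have /eqP : i * (ip x x + ip y y) = 0 by lra.
  rewrite mulf_eq0 => /orP[/eqP//|]; rewrite paddr_eq0// => /andP[/eqP x0' /eqP y0'].
  by case: xy; split; apply: (ip_eq0 ipP).
have [u [Vu u0 Au]] : exists u, [/\ V u, u <> 0 &
    error_operator V S1 S2 gamma1 gamma2 theta u = a *: u].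
  have [x0|/eqP x0] := eqVneq x 0; last first.
    by exists x; split => //; rewrite Ax i0 scale0r subr0.
  exists y; split => //; first by move=> y0; apply: xy.
  by rewrite Ay i0 scale0r add0r.
have -> : ComplexField.Normc.normc z = `|a|.
  rewrite (_ : z = Complex a i); last by rewrite /a /i; case: (z).
  by rewrite /= i0 expr0n addr0 sqrtr_sqr.
have [d Vd [uE RuE]] := error_operatorE Vu.
have d0 : d <> 0.
  move=> d0; apply: u0; rewrite uE /Q d0 !(linear_on0 sV lS).
  by rewrite !scaler0 !addr0.
have VSd := VS Vd.
have theta0 : 0 < theta by rewrite thetaE divr_gt0// addr_gt0.
(* Substituting [u = Q d] in the eigenvalue equation gives [(1 - a) Q d - theta b S d = 0], a
   quadratic in [S] that annihilates [d]. *)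
have [] := @quadratic_eigenvector _ _ _ sV _ ipP _ lS sS ((1 - a) * (nu1 * nu2))
  ((1 - a) * (gamma1 * nu2 + gamma2 * nu1) - theta * b)
  ((1 - a) * (gamma1 * gamma2)) d Vd d0.
- have AuQ : Q d - (theta * b) *: S d = a *: Q d by rewrite -RuE Au uE.
  apply/funext => t.
  have h : Q d t - theta * b * S d t = a * Q d t := congr1 (@^~ t) AuQ.
  apply: (etrans _ (subrr (a * Q d t))); rewrite -{1}h /Q !fctE /GRing.scale /=.
  ring.
(* A vanishing leading coefficient means [a = 1]; the linear coefficient is then [- theta * b],
   which is nonzero. *)
- rewrite -negb_and; apply/negP => /andP[/eqP h1 /eqP h2].
  have nu120 : nu1 * nu2 != 0 by rewrite mulf_neq0// lt0r_neq0.
  have a1 : 1 - a = 0 by apply/eqP; move/eqP: h1; rewrite mulf_eq0 (negPf nu120) orbF.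
  move/eqP: h2; rewrite a1 mul0r sub0r oppr_eq0 mulf_eq0 gt_eqF//=.
  have g1 : 0 <= gamma1 by apply: le_trans gamma1_ge; rewrite mulr_ge0// ltW.
  apply/negP; rewrite gt_eqF// /b -addrA addrACA -!mulrDr.
  by apply: ltr_wpDl; [rewrite mulr_ge0// ltW// addr_gt0|rewrite mulr_gt0// addr_gt0].
move=> lam [v [Vv v0 Sv quad]].
have /andP[lam_ge lam_le] := real_eigenvalue Vv v0 Sv.
have lam0 : 0 < lam by exact: lt_le_trans lam_ge.
have g1 : nu2 * lam <= gamma1 by apply: le_trans gamma1_ge; rewrite ler_pM2l.
have g2 : gamma2 <= nu1 * lam.
  by apply: (le_trans gamma2_le); rewrite mulrC ler_pM2l.
have g10 : 0 < gamma1 by apply: lt_le_trans g1; exact: mulr_gt0.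
pose q := (gamma1 + nu1 * lam) * (gamma2 + nu2 * lam).
pose k := (gamma1 - nu2 * lam) * (nu1 * lam - gamma2).
have q0 : 0 < q by apply: mulr_gt0; apply: addr_gt0 => //; exact: mulr_gt0.
(* At the eigenvalue [lam] one has [b * lam = q + k], so the quadratic says
   [a = 1 - theta (1 + k / q)]; here [k] is only the numerator of the quotient. *)
have aq : a * q = (1 - theta) * q - theta * k.
  by apply/eqP; rewrite eq_sym -subr_eq0 -quad /q /k /b; apply/eqP; ring.
have k0 : 0 <= k by apply: mulr_ge0; rewrite subr_ge0.
have kq : k <= nu1 / nu2 * q.
  rewrite mulrAC ler_pdivlMr// /k /q.
  have -> : nu1 * ((gamma1 + nu1 * lam) * (gamma2 + nu2 * lam)) =
    (gamma1 + nu1 * lam) * (nu1 * gamma2 + nu1 * nu2 * lam) by ring.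
  have := mulr_gt0 nu1_gt0 lam0; have := mulr_gt0 nu2_gt0 lam0.
  have := mulr_gt0 nu1_gt0 gamma2_gt0; have := mulr_gt0 nu2_gt0 gamma2_gt0.
  move=> *; rewrite -[leLHS]mulrA; apply: ler_pM.
  - by rewrite subr_ge0.
  - by rewrite mulr_ge0 ?subr_ge0// ltW.
  - lra.
  - rewrite mulrBl; lra.
set r := nu1 / nu2 in r0 thetaE kq *.
have th2 : theta * (2 + r) = 2 by rewrite thetaE divfK// lt0r_neq0// addr_gt0.
(* This identity is what the choice of [theta] achieves: as [k / q] runs over [[0, r]], the value
   [1 - theta - theta k / q] stays between [- (1 - theta)] and [1 - theta], and [1 - theta <= r]. *)
have tr : theta * r = 2 - 2 * theta by lra.
have th1 : 0 <= 1 - theta.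
  have := mulr_gt0 theta0 r0; lra.
have th1r : 1 - theta <= r.
  rewrite -subr_ge0; have := mulr_gt0 theta0 r0; have := mulr_gt0 r0 r0.
  by move=> ? ?; have := mulr_gt0 theta0 r0; nra.
have tk : theta * k <= (2 - 2 * theta) * q.
  by rewrite -tr -mulrA ler_pM2l.
have tk0 : 0 <= theta * k by rewrite mulr_ge0// ltW.
have rq : (1 - theta) * q <= r * q by rewrite ler_pM2r.
rewrite ler_norml; apply/andP; split; rewrite -(ler_pM2r q0) aq; last by lra.
by rewrite mulNr; lra.
Qed.

End RobinRobin.

(** * Lebesgue measure of the plane *)

Section NullSets.
Import HBNNSimple.
Local Open Scope ereal_scope.
Context d (T : measurableType d) (R : realType).
Variables (mu : {measure set T -> \bar R}) (N : set T).
Hypotheses (mN : measurable N) (N0 : mu N = 0).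

(* Neither function is assumed measurable: a simple function below [f] is cut
   off on [N] without changing its integral. *)
Lemma ge0_integral_eq_off_null (f g : T -> \bar R) :
  (forall x, 0 <= f x) -> (forall x, 0 <= g x) ->
  (forall x, ~ N x -> f x = g x) -> \int[mu]_x f x = \int[mu]_x g x.
Proof.
have main (f' g' : T -> \bar R) : (forall x, 0 <= f' x) -> (forall x, 0 <= g' x) ->
    (forall x, ~ N x -> f' x = g' x) -> \int[mu]_x f' x <= \int[mu]_x g' x.
  move=> f0 g0 fg; rewrite !ge0_integralTE//.
  apply: ub_ereal_sup => _ [h /= hf <-].
  have mNC : measurable (~` N) by exact: measurableC.
  apply: ereal_sup_ubound; exists (proj_nnsfun h mNC).
    move=> x /=; rewrite mindicE; have [xN|xN] := boolP (x \in ~` N).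
      by rewrite mulr1 -fg//; exact: set_mem.
    by rewrite mulr0.
  rewrite -!integralT_nnsfun; apply: ae_eq_integral => //.
  - exact/measurable_EFinP.
  - exact/measurable_EFinP.
  exists N; split => // x /= /not_implyP[_]; apply: contra_notP => xN.
  by rewrite mindicE mem_set ?mulr1.
by move=> f0 g0 fg; apply/eqP; rewrite eq_le !main// => x /fg.
Qed.

Lemma integral_eq_off_null (f g : T -> \bar R) :
  (forall x, ~ N x -> f x = g x) -> \int[mu]_x f x = \int[mu]_x g x.
Proof.
move=> fg; rewrite integralE [RHS]integralE.
congr (_ - _); apply: ge0_integral_eq_off_null => // x xN.
  by rewrite !funeposE fg.
by rewrite !funenegE fg.
Qed.

End NullSets.

(** * Measure-preserving shears and reflections of the plane *)

Section PlaneMeasure.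
Context {R : realType}.
Local Notation lambda := (@lebesgue_measure R).
Local Notation mu2 := (@lebesgue_measure R \x @lebesgue_measure R)%E.
Local Notation plane := (measurableTypeR R * measurableTypeR R)%type.

Lemma measurable_affine1 (a c : R) :
  measurable_fun setT ((fun y => a * y + c) : measurableTypeR R -> measurableTypeR R).
Proof.
by apply: measurable_funD => //; exact: measurable_funM.
Qed.

(** The image measure under the translation agrees with the Lebesgue measure on half-open intervals,
    which determine the latter. *)
Lemma lebesgue_measure_translation (c : R) (A : set (measurableTypeR R)) : measurable A ->
  lambda ((fun y => y + c) @^-1` A) = lambda A.
Proof.
move=> mA.
have mf : measurable_fun setT ((fun y => y + c) : measurableTypeR R -> measurableTypeR R).
  by apply: measurable_funD.
pose f : {mfun measurableTypeR R >-> measurableTypeR R} :=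
  HB.pack ((fun y => y + c) : measurableTypeR R -> measurableTypeR R)
   (isMeasurableFun.Build _ _ _ _ _ mf).
rewrite -[LHS]/(pushforward lambda f A).
apply/esym/lebesgue_measure_unique => //= _ [[a b]] _ <-.
rewrite /pushforward (_ : _ @^-1` _ = `]a - c, b - c]%classic); last first.
  by apply/seteqP; split => x /=; rewrite !in_itv/= ltrBlDr lerBrDr.
rewrite !lebesgue_measure_itv/=.
rewrite !lte_fin ltrD2r -!EFinD; case: ifP => // _; congr (_%:E); ring.
Qed.

Lemma lebesgue_measure_signed_translation (s : bool) (c : R)
    (A : set (measurableTypeR R)) : measurable A ->
  lambda ((fun y => (-1) ^+ s * y + c) @^-1` A) = lambda A.
Proof.
move=> mA; have mAc : measurable ((fun y => y + c) @^-1` A : set (measurableTypeR R)).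
  by rewrite -[_ @^-1` _]setTI; apply: measurable_funD.
rewrite -[RHS](lebesgue_measure_translation c)//; case: s; last first.
  by rewrite expr0; congr (lambda _); apply/funext => y /=; rewrite mul1r.
rewrite -[RHS]lebesgue_measureN// /pushforward.
by congr (lambda _); apply/funext => y /=; rewrite expr1 mulN1r.
Qed.

Definition measure_preserving (f : plane -> plane) :=
  measurable_fun setT f /\
  forall A, measurable A -> mu2 (f @^-1` A) = mu2 A.

Lemma measure_preserving_comp f g : measure_preserving f ->
  measure_preserving g -> measure_preserving (f \o g).
Proof.
move=> [mf pf] [mg pg]; split; first exact: measurableT_comp.
move=> A mA; rewrite comp_preimage pg ?pf//.
by rewrite -[_ @^-1` _]setTI; exact: mf.
Qed.

(** Integrating the measures of horizontal or of vertical sections gives the same product measure;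
    this allows shears along either axis to be treated section by section. *)
Lemma plane_measureE (A : set plane) : measurable A -> mu2 A = (lambda \x^ lambda)%E A.
Proof.
by move=> mA; apply: product_measure_unique => // *; exact: product_measure2E.
Qed.

(** On each vertical section the map is a translation, possibly composed with a sign change, and so
    preserves its length. *)
Lemma measure_preserving_yshear (s : bool) (phi : measurableTypeR R -> measurableTypeR R) :
  measurable_fun setT phi ->
  measure_preserving (fun x => (x.1, (-1) ^+ s * x.2 + phi x.1)).
Proof.
move=> mphi; split.
  apply/measurable_fun_pairP; split => /=; first exact: measurable_fst.
  apply: measurable_funD; last exact: measurableT_comp.
  by apply: measurable_funM => //; exact: measurable_snd.
move=> A mA; apply: eq_integral => x _ /=.
rewrite -[in RHS](lebesgue_measure_signed_translation s (phi x)).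
  by congr (lambda _); apply/funext => y; rewrite /xsection /= !mem_setE.
exact: measurable_xsection.
Qed.

Lemma measure_preserving_xshear (s : bool) (phi : measurableTypeR R -> measurableTypeR R) :
  measurable_fun setT phi ->
  measure_preserving (fun x => ((-1) ^+ s * x.1 + phi x.2, x.2)).
Proof.
move=> mphi.
have mf : measurable_fun setT (fun x : plane => ((-1) ^+ s * x.1 + phi x.2, x.2) : plane).
  apply/measurable_fun_pairP; split => /=; last exact: measurable_snd.
  apply: measurable_funD; last exact: measurableT_comp.
  by apply: measurable_funM => //; exact: measurable_fst.
split=> // A mA; rewrite !plane_measureE//; last by rewrite -[_ @^-1` _]setTI; exact: mf.
apply: eq_integral => x _ /=.
rewrite -[in RHS](lebesgue_measure_signed_translation s (phi x)).
  by congr (lambda _); apply/funext => y; rewrite /ysection /= !mem_setE.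
exact: measurable_ysection.
Qed.

Lemma measurable_affine2 (a b c : R) :
  measurable_fun setT ((fun x => a * x.1 + b * x.2 + c) : plane -> measurableTypeR R).
Proof.
apply: measurable_funD => //; apply: measurable_funD; apply: measurable_funM => //.
Qed.

Lemma measurable_line (a b c : R) :
  measurable ([set x : plane | a * x.1 + b * x.2 + c = 0]).
Proof.
rewrite (_ : [set _ | _] = (fun x => a * x.1 + b * x.2 + c) @^-1` [set 0])//.
by rewrite -[_ @^-1` _]setTI; apply: measurable_affine2.
Qed.

Lemma measurable_half_plane (a b c : R) :
  measurable ([set x : plane | 0 < a * x.1 + b * x.2 + c]).
Proof.
rewrite (_ : [set _ | _] = (fun x => a * x.1 + b * x.2 + c) @^-1` `]0, +oo[%classic).
  by rewrite -[_ @^-1` _]setTI; apply: measurable_affine2.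
by apply/seteqP; split => x /=; rewrite in_itv/= andbT.
Qed.

(** Sliced along an axis to which it is not parallel, the line has one-point sections; the sign of
    [b] being irrelevant, only its vanishing decides which axis to use. *)
Lemma plane_measure_line (a b c : R) : (a != 0) || (b != 0) ->
  mu2 [set x | a * x.1 + b * x.2 + c = 0] = 0%E.
Proof.
move=> ab; have mL := measurable_line a b c.
have [b0|b0] := eqVneq b 0; last first.
  rewrite -[LHS]/(\int[lambda]_x _)%E; apply: integral0_eq => x _ /=.
  rewrite xsectionE (_ : _ @^-1` _ = [set (- (a * x + c) / b)]) ?lebesgue_measure_set1//.
  apply/seteqP; split => y /=.
    by move=> h; rewrite -[y](mulfK b0); congr (_ / _); lra.
  by move=> ->; field.
have a0 : a != 0 by move: ab; rewrite b0 eqxx orbF.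
rewrite plane_measureE//.
rewrite -[LHS]/(\int[lambda]_x _)%E; apply: integral0_eq => y _ /=.
rewrite ysectionE (_ : _ @^-1` _ = [set (- (b * y + c) / a)]) ?lebesgue_measure_set1//.
apply/seteqP; split => x /=.
  by move=> h; rewrite -[x](mulfK a0); congr (_ / _); lra.
by move=> ->; field.
Qed.

Lemma reflectionE (p n x : R * R) : reflection p n x =
  (x.1 - 2 * ((x.1 - p.1) * n.1 + (x.2 - p.2) * n.2) * n.1,
   x.2 - 2 * ((x.1 - p.1) * n.1 + (x.2 - p.2) * n.2) * n.2).
Proof. by []. Qed.

(* A shear along the first axis takes [n] to a vertical vector, which turns the
   reflection into a vertical one followed by a vertical shear. *)
Lemma measure_preserving_reflection (p n : R * R) : dot n n = 1 ->
  measure_preserving (reflection p n : plane -> plane).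
Proof.
rewrite /dot => n1.
(* A horizontal normal cannot be sheared along the first axis to a vertical one; the reflection is
   then simply [x.1] to [2 * p.1 - x.1]. *)
have [n20|n20] := eqVneq n.2 0.
  have := @measure_preserving_xshear true (cst (2 * p.1)) (measurable_cst _).
  congr (measure_preserving _); apply/funext => -[x1 x2].
  rewrite n20 mulr0 addr0 in n1.
  rewrite reflectionE /= n20; congr pair; last by ring.
  have -> : - (2 * ((x1 - p.1) * n.1 + (x2 - p.2) * 0) * n.1) =
    - (2 * (x1 - p.1)) * (n.1 * n.1) by ring.
  by rewrite n1; ring.
pose k := n.1 / n.2.
have shear c : measurable_fun setT (fun y : R => c * y) by exact: measurable_funM.
have mphi : measurable_fun setT
    (fun x : R => (- (2 * n.1 * n.2)) * x + (2 * n.1 * n.2 * p.1 + 2 * n.2 * n.2 * p.2)).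
  exact: measurable_affine1.
have := measure_preserving_comp (measure_preserving_xshear false (shear k))
  (measure_preserving_comp (measure_preserving_yshear true mphi)
    (measure_preserving_xshear false (shear (- k)))).
congr (measure_preserving _); apply/funext => -[x1 x2].
rewrite reflectionE /= !(expr0, expr1).
have n1' : n.1 * n.1 = 1 - n.2 * n.2 by lra.
have e2 : -1 * x2 + (- (2 * n.1 * n.2) * (1 * x1 + - k * x2) +
      (2 * n.1 * n.2 * p.1 + 2 * n.2 * n.2 * p.2)) =
    x2 - 2 * ((x1 - p.1) * n.1 + (x2 - p.2) * n.2) * n.2.
  rewrite (_ : _ * (1 * x1 + - k * x2) = - (2 * n.1 * n.2) * x1 + 2 * (n.1 * n.1) * x2).
    by rewrite n1'; ring.
  by rewrite /k; field.
rewrite e2; by congr pair; rewrite /k; field.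
Qed.

Lemma integral_measure_preserving (f : plane -> plane) (F : plane -> \bar R) :
  measure_preserving f -> measurable_fun setT F ->
  (\int[mu2]_x F (f x) = \int[mu2]_x F x)%E.
Proof.
move=> [mf pf] mF.
pose f' : {mfun plane >-> plane} :=
  HB.pack f (isMeasurableFun.Build _ _ _ _ _ mf).
have ge0 (G : plane -> \bar R) : measurable_fun setT G -> (forall x, 0 <= G x)%E ->
    (\int[mu2]_x G (f x) = \int[mu2]_x G x)%E.
  move=> mG G0; transitivity (\int[pushforward mu2 f']_x G x)%E; last first.
    by apply: eq_measure_integral => A mA _; exact: pf.
  by rewrite (ge0_integral_pushforward mf)// preimage_setT.
rewrite -[LHS]/(\int[mu2]_x (F \o f) x)%E integralE [RHS]integralE.
rewrite (funepos_comp F f) (funeneg_comp F f).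
by congr (_ - _)%E; apply: ge0 => //; [exact: measurable_funepos|exact: measurable_funeneg].
Qed.

End PlaneMeasure.

(** * Triangles of a mesh *)

Section Triangles.
Context {R : realType}.
Variables (M : mesh R).
Local Notation N := (nb_nodes M).
Local Notation p := (@node R M).
Local Notation mu2 := (@lebesgue_measure R \x @lebesgue_measure R)%E.
Implicit Types (T : {set 'I_N}) (x y z a b c : R * R) (i j k : 'I_N).

(** Twice the signed area of the triangle [a b c]; it vanishes exactly when the three points are
    collinear. *)
Definition area2 a b c : R :=
  (b.1 - a.1) * (c.2 - a.2) - (b.2 - a.2) * (c.1 - a.1).

Lemma continuous_affine2 (a b c : R) :
  continuous (fun x : R * R => a * x.1 + b * x.2 + c).
Proof.
move=> x; apply: cvgD; last exact: cvg_cst.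
by apply: cvgD; apply: cvgM; (exact: cvg_cst || exact: cvg_fst || exact: cvg_snd).
Qed.

Lemma area2_affine a b c : area2 a b c =
  (a.2 - b.2) * c.1 + (b.1 - a.1) * c.2 + (a.1 * b.2 - a.2 * b.1).
Proof. by rewrite /area2; ring. Qed.

Lemma nbhs_line x (d : R * R) (A : set (R * R)) : nbhs x A ->
  exists2 e, 0 < e & forall t, `|t| < e -> A (x + t *: d).
Proof.
move=> xA; have : \forall t \near (0 : R), A (x + t *: d).
  have : (fun t : R => x + t *: d) @ 0 --> x.
    rewrite -[X in _ --> X]addr0 -(scale0r d).
    by apply: cvgD; [exact: cvg_cst|apply: cvgZl; exact: cvg_id].
  exact.
move=> /nbhs_ballP[e /= e0 eA]; exists e => // t te.
by apply: eA; rewrite /ball /= sub0r normrN.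
Qed.

(* The lines through two nodes; outside of this null set every point of the
   domain is interior to exactly one triangle. *)
Definition edge_lines : set (R * R) :=
  [set x | exists i j, i != j /\ area2 (p i) (p j) x = 0].

Definition open_cell T : set (R * R) :=
  [set x | exists l : 'I_N -> R,
     [/\ forall i, i \in T -> 0 < l i, forall i, i \notin T -> l i = 0,
         \sum_i l i = 1 & x = \sum_i l i *: p i]].

Lemma open_cell_sub T : open_cell T `<=` cell T.
Proof.
move=> x [l [l0 lT l1 ->]]; exists l; split => // i.
by have [/l0/ltW//|/lT ->] := boolP (i \in T).
Qed.

Lemma cell_sub T T' : T \subset T' -> cell T `<=` cell T'.
Proof.
move=> TT' x [l [l0 lT l1 ->]]; exists l; split => // i iT'.
by apply: lT; apply: contra iT'; exact: (fintype.subsetP TT').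
Qed.

Lemma open_cell_convex T x y (t : R) : 0 <= t -> t <= 1 ->
  open_cell T x -> open_cell T y -> open_cell T ((1 - t) *: x + t *: y).
Proof.
move=> t0 t1 [l [l0 lT l1 ->]] [m [m0 mT m1 ->]].
exists (fun i => (1 - t) * l i + t * m i); split.
- move=> i iT; have := l0 _ iT; have := m0 _ iT => mi li.
  have [->|tn0] := eqVneq t 0; first by lra.
  apply: ltr_wpDl; first by rewrite mulr_ge0 ?subr_ge0// ltW.
  by rewrite mulr_gt0// lt_neqAle eq_sym tn0.
- by move=> i iT; rewrite lT// mT// !mulr0 addr0.
- by rewrite big_split/= -!mulr_sumr l1 m1; ring.
- rewrite !scaler_sumr -big_split/=; apply: eq_bigr => i _.
  by rewrite !scalerA scalerDl.
Qed.

Lemma sum_set3 (V : nmodType) (F : 'I_N -> V) i j k :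
  i != j -> i != k -> j != k -> (forall m, m \notin [set i; j; k]%SET -> F m = 0) ->
  \sum_m F m = F i + F j + F k.
Proof.
move=> ij ik jk F0.
rewrite (bigD1 i)//= (bigD1 j) 1?eq_sym//= (bigD1 k)/=; last first.
  by rewrite eq_sym ik eq_sym jk.
rewrite big1 ?addr0 ?addrA// => m /andP[/andP[mi mj] mk].
by rewrite F0// !finset.inE !negb_or mi mj mk.
Qed.

Lemma sum_set2 (V : nmodType) (F : 'I_N -> V) i j :
  i != j -> (forall m, m \notin [set i; j]%SET -> F m = 0) ->
  \sum_m F m = F i + F j.
Proof.
move=> ij F0.
rewrite (bigD1 i)//= (bigD1 j) 1?eq_sym//=.
rewrite big1 ?addr0// => m /andP[mi mj].
by rewrite F0// !finset.inE !negb_or mi mj.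
Qed.

Lemma open_cell3P i j k x : i != j -> i != k -> j != k ->
  (exists a b c : R, [/\ 0 < a, 0 < b, 0 < c, a + b + c = 1 &
     x = a *: p i + b *: p j + c *: p k]) <-> open_cell [set i; j; k]%SET x.
Proof.
move=> ij ik jk; split.
  move=> [a [b [c [a0 b0 c0 abc ->]]]].
  pose l m := if m == i then a else if m == j then b else if m == k then c else 0.
  have li : l i = a by rewrite /l eqxx.
  have lj : l j = b by rewrite /l eq_sym (negPf ij) eqxx.
  have lk : l k = c by rewrite /l eq_sym (negPf ik) eq_sym (negPf jk) eqxx.
  have lT m : m \notin [set i; j; k]%SET -> l m = 0.
    by rewrite !finset.inE !negb_or /l => /andP[/andP[/negPf-> /negPf->] /negPf->].
  exists l; split => //.
  - by move=> m; rewrite !finset.inE => /orP[/orP[]|] /eqP ->; rewrite ?li ?lj ?lk.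
  - by rewrite (sum_set3 ij ik jk)// li lj lk.
  - rewrite (sum_set3 ij ik jk) ?li ?lj ?lk// => m mT.
    by rewrite lT// scale0r.
move=> [l [l0 lT l1 ->]]; exists (l i), (l j), (l k); split.
- by apply: l0; rewrite !finset.inE eqxx.
- by apply: l0; rewrite !finset.inE eqxx orbT.
- by apply: l0; rewrite !finset.inE eqxx !orbT.
- by rewrite -(sum_set3 ij ik jk).
- by rewrite (sum_set3 ij ik jk)// => m mT; rewrite lT// scale0r.
Qed.

Lemma cell3P i j k x : i != j -> i != k -> j != k ->
  cell [set i; j; k]%SET x ->
  exists a b c : R, [/\ 0 <= a, 0 <= b, 0 <= c, a + b + c = 1 &
     x = a *: p i + b *: p j + c *: p k].
Proof.
move=> ij ik jk [l [l0 lT l1 ->]]; exists (l i), (l j), (l k); split => //.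
- by rewrite -(sum_set3 ij ik jk).
- by rewrite (sum_set3 ij ik jk)// => m mT; rewrite lT// scale0r.
Qed.

Lemma cell2P i j x : i != j ->
  cell [set i; j]%SET x <-> closed_segment (p i) (p j) x.
Proof.
move=> ij; split.
  move=> [l [l0 lT l1 ->]].
  move: l1; rewrite (sum_set2 ij)// => l1.
  rewrite (sum_set2 ij); last by move=> m mT; rewrite lT// scale0r.
  exists (l j) => /=; first by rewrite in_itv/= l0/= -l1 lerDr.
  by congr (_ *: _ + _); rewrite -l1 addrK.
move=> [t]; rewrite /= in_itv/= => /andP[t0 t1] <-.
pose l m := if m == i then 1 - t else if m == j then t else 0.
have li : l i = 1 - t by rewrite /l eqxx.
have lj : l j = t by rewrite /l eq_sym (negPf ij) eqxx.
have lT m : m \notin [set i; j]%SET -> l m = 0.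
  by rewrite !finset.inE !negb_or /l => /andP[/negPf-> /negPf->].
exists l; split => //.
- by move=> m; rewrite /l; case: ifP => _; [by rewrite subr_ge0|by case: ifP].
- by rewrite (sum_set2 ij)// li lj subrK.
- by rewrite (sum_set2 ij) ?li ?lj// => m mT; rewrite lT// scale0r.
Qed.

Lemma set3_of_card T : #|T| = 3%N ->
  exists i j k, [/\ i != j, i != k, j != k & T = [set i; j; k]%SET].
Proof.
move=> T3; have /card_gt2P[i [j [k [[iT jT kT] [ij jk ki]]]]] : (2 < #|T|)%N by rewrite T3.
have ik : i != k by rewrite eq_sym.
exists i, j, k; split => //; apply/eqP; rewrite eq_sym eqEcard T3; apply/andP; split.
  by apply/fintype.subsetP => m; rewrite !finset.inE => /orP[/orP[]|] /eqP ->.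
rewrite -finset.setUA cardsU1 cards2 !finset.inE negb_or ij ik jk//.
Qed.

Lemma set3_of_mem T i : #|T| = 3%N -> i \in T ->
  exists j k, [/\ i != j, i != k, j != k & T = [set i; j; k]%SET].
Proof.
move=> /set3_of_card[a [b [c [ab ac bc ->]]]].
rewrite !finset.inE => /orP[/orP[]|] /eqP ->.
- by exists b, c.
- exists a, c; rewrite (eq_sym b a); split => //.
  by congr (_ :|: _); rewrite finset.setUC.
- exists a, b; rewrite (eq_sym c a) (eq_sym c b); split => //.
  by rewrite [LHS]finset.setUC finset.setUA.
Qed.

Section Triangulation.
Variables (Omega : set (R * R)).
Hypothesis tri : triangulation Omega M.

Lemma node_inj : injective p. Proof. by case: tri. Qed.

(* A triangle with nonempty interior is nondegenerate: a whole neighbourhood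
   of a point cannot lie on one line. *)
Lemma area2_neq0 i j k : i != j -> i != k -> j != k ->
  [set i; j; k]%SET \in tris M -> area2 (p i) (p j) (p k) != 0.
Proof.
move=> ij ik jk Tt; apply/eqP => D0.
have [_ _ /(_ _ Tt)[_ [z zT] _] _] := tri.
have onl y : cell [set i; j; k]%SET y -> area2 (p i) (p j) y = 0.
  move=> /(cell3P ij ik jk)[a [b [c [_ _ _ abc ->]]]].
  have -> : area2 (p i) (p j) (a *: p i + b *: p j + c *: p k) =
      (1 - (a + b + c)) * ((p i).1 * (p j).2 - (p i).2 * (p j).1)
       + c * area2 (p i) (p j) (p k) .
    by rewrite /area2 /= /GRing.scale /=; ring.
  by rewrite D0 mulr0 addr0 abc subrr mul0r.
pose d : R * R := ((p i).2 - (p j).2, (p j).1 - (p i).1).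
have [e e0 eA] := nbhs_line d zT.
have e2 : `|e / 2| < e by rewrite gtr0_norm ?divr_gt0// ltr_pdivrMr// ltr_pMr// ltr1n.
have := onl _ (eA _ e2); have := onl _ (nbhs_singleton zT).
have -> : area2 (p i) (p j) (z + (e / 2) *: d) =
    area2 (p i) (p j) z + e / 2 * (d.1 ^+ 2 + d.2 ^+ 2).
  by rewrite /area2 /= /GRing.scale /=; ring.
move=> -> /eqP; rewrite add0r mulf_eq0 gt_eqF ?divr_gt0//= paddr_eq0 ?sqr_ge0//.
rewrite !sqrf_eq0 /= !subr_eq0 => /andP[/eqP d1 /eqP d2].
move/eqP: ij; apply; apply: node_inj.
by move: d1 d2; case: (p i) (p j) => ? ? [? ?] /= -> ->.
Qed.

(** A vanishing barycentric coordinate puts the point on the line through the other two vertices. *)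
Lemma cell_edge_lines T x i : T \in tris M -> i \in T ->
  (exists l : 'I_N -> R, [/\ forall m, m \notin T -> l m = 0,
    \sum_m l m = 1, l i = 0 & x = \sum_m l m *: p m]) -> edge_lines x.
Proof.
move=> Tt iT [l [lT l1 li ->]].
have [_ _ /(_ _ Tt)[T3 _ _] _] := tri.
have [j [k [ij ik jk TE]]] := set3_of_mem T3 iT.
exists j, k; split => //; rewrite TE in lT.
move: l1; rewrite (sum_set3 ij ik jk)// li add0r => l1.
rewrite (sum_set3 ij ik jk) ?li ?scale0r ?add0r; last first.
  by move=> m mT; rewrite lT// scale0r.
have -> : l j = 1 - l k by rewrite -l1 addrK.
by rewrite /area2 /= /GRing.scale /=; ring.
Qed.

Lemma cell_open_cell T x : T \in tris M -> cell T x -> ~ edge_lines x ->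
  open_cell T x.
Proof.
move=> Tt [l [l0 lT l1 xE]] xN; exists l; split => // i iT.
rewrite lt_neqAle l0 andbT eq_sym; apply/eqP => li; apply: xN.
by apply: (cell_edge_lines Tt iT); exists l.
Qed.

(** By conformity [x] has barycentric coordinates supported on the common vertices; were a vertex of
    [T] missing from [T'], its coordinate would vanish and [x] would lie on an edge line. *)
Lemma cell_unique T T' x : T \in tris M -> T' \in tris M ->
  cell T x -> cell T' x -> ~ edge_lines x -> T = T'.
Proof.
move=> Tt Tt' Tx Tx' xN.
have [_ _ card conf] := tri.
have : cell (T :&: T') x by rewrite -conf.
move=> [l [l0 lT l1 xE]].
suff TT' : T \subset T'.
  have [T3 _ _] := card _ Tt; have [T3' _ _] := card _ Tt'.
  by apply/eqP; rewrite eqEcard TT' T3 T3'.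
apply/fintype.subsetP => i iT; apply: contrapT => /negP iT'.
apply: xN; apply: (cell_edge_lines Tt iT); exists l; split => //.
- by move=> m mT; apply: lT; rewrite finset.inE negb_and mT.
- by apply: lT; rewrite finset.inE negb_and iT' orbT.
Qed.

(** Barycentric coordinates are quotients of signed areas by [D] (Cramer's rule), and multiplying by
    [D] tests their sign for either orientation. The open triangle is thus an intersection of three
    open half-planes. *)
Lemma open_cell_area2 i j k x : i != j -> i != k -> j != k ->
  [set i; j; k]%SET \in tris M ->
  let D := area2 (p i) (p j) (p k) in
  open_cell [set i; j; k]%SET x <->
  [/\ 0 < area2 (p j) (p k) x * D, 0 < area2 (p k) (p i) x * D &
      0 < area2 (p i) (p j) x * D].
Proof.
move=> ij ik jk Tt D; have D0 : D != 0 by exact: area2_neq0.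
have D2 : 0 < D ^+ 2 by rewrite exprn_even_gt0.
split.
  move=> /(open_cell3P _ ij ik jk)[a [b [c [a0 b0 c0 abc ->]]]].
  have aE : a = 1 - b - c by lra.
  set x' := _ + _.
  have ea : area2 (p j) (p k) x' = a * D.
    by rewrite /x' aE /D /area2 /= /GRing.scale /=; ring.
  have eb : area2 (p k) (p i) x' = b * D.
    by rewrite /x' aE /D /area2 /= /GRing.scale /=; ring.
  have ec : area2 (p i) (p j) x' = c * D.
    by rewrite /x' aE /D /area2 /= /GRing.scale /=; ring.
  by rewrite ea eb ec -!mulrA -expr2; split; exact: mulr_gt0.
move=> [a0 b0 c0]; apply/(open_cell3P _ ij ik jk).
have pos u : 0 < u * D -> 0 < u / D.
  by move=> u0; rewrite (_ : u / D = u * D / D ^+ 2) ?divr_gt0//; field.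
exists (area2 (p j) (p k) x / D), (area2 (p k) (p i) x / D), (area2 (p i) (p j) x / D).
split; [exact: pos..| |].
  rewrite -!mulrDl -[RHS](divff D0); congr (_ / _).
  by rewrite /D /area2; ring.
case: x a0 b0 c0 => x1 x2 _ _ _.
rewrite -![_ / D]mulrC -!scalerA -!scalerDr.
apply: (scalerI D0); rewrite scalerA divff// scale1r.
by congr pair; rewrite /= /GRing.scale /= /D /area2 /=; ring.
Qed.

Lemma open_cell_nbhs T x : T \in tris M -> open_cell T x ->
  \forall y \near x, open_cell T y.
Proof.
move=> Tt; have [_ _ /(_ _ Tt)[/set3_of_card[i [j [k [ij ik jk TE]]]] _ _] _] := tri.
rewrite TE in Tt *; move=> /(open_cell_area2 _ ij ik jk Tt) /=.
set D := area2 (p i) (p j) (p k) => -[a0 b0 c0].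
have cont (a b : R * R) : 0 < area2 a b x * D -> \forall y \near x, 0 < area2 a b y * D.
  have : (fun y => area2 a b y * D) @ x --> area2 a b x * D.
    apply: cvgM; last exact: cvg_cst.
    have -> : area2 a b = fun y => (a.2 - b.2) * y.1 + (b.1 - a.1) * y.2 +
      (a.1 * b.2 - a.2 * b.1) by apply/funext => y; exact: area2_affine.
    exact: continuous_affine2.
  by move=> /cvgr_gt h /h.
near=> y; apply/(open_cell_area2 _ ij ik jk Tt); split; near: y;
  [exact: cont a0|exact: cont b0|exact: cont c0].
Unshelve. all: by end_near. Qed.

Lemma measurable_open_cell T : T \in tris M ->
  measurable (open_cell T : set (measurableTypeR R * measurableTypeR R)).
Proof.
move=> Tt; have [_ _ /(_ _ Tt)[/set3_of_card[i [j [k [ij ik jk TE]]]] _ _] _] := tri.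
rewrite TE in Tt *.
set D := area2 (p i) (p j) (p k).
have mh (a b : R * R) : measurable ([set x | 0 < area2 a b x * D] :
    set (measurableTypeR R * measurableTypeR R)).
  rewrite (_ : [set _ | _] = [set x | 0 < (a.2 - b.2) * D * x.1 + (b.1 - a.1) * D * x.2 +
      (a.1 * b.2 - a.2 * b.1) * D]); first exact: measurable_half_plane.
  by apply/seteqP; split=> x /=; rewrite area2_affine !mulrDl;
     move=> h; congr (0 < _): h; ring.
rewrite (_ : open_cell _ = [set x | 0 < area2 (p j) (p k) x * D] `&`
  [set x | 0 < area2 (p k) (p i) x * D] `&` [set x | 0 < area2 (p i) (p j) x * D]).
  by do 2 ?apply: measurableI.
apply/seteqP; split => x.
  by move=> /(open_cell_area2 _ ij ik jk Tt)[].
by move=> [[? ?] ?]; apply/(open_cell_area2 _ ij ik jk Tt).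
Qed.

Lemma open_cell_nonempty T : T \in tris M -> open_cell T !=set0.
Proof.
move=> Tt; have [_ _ /(_ _ Tt)[/set3_of_card[i [j [k [ij ik jk ->]]]] _ _] _] := tri.
exists (3^-1 *: p i + 3^-1 *: p j + 3^-1 *: p k).
by apply/(open_cell3P _ ij ik jk); exists 3^-1, 3^-1, 3^-1; split => //; field.
Qed.

(** A point of the closed triangle is approached by moving it slightly towards a fixed point [b] of
    the open one. *)
Lemma cell_sub_closure T : T \in tris M -> cell T `<=` closure (open_cell T).
Proof.
move=> Tt x [l [l0 lT l1 xE]] B xB.
have [b [m [m0 mT m1 bE]]] := open_cell_nonempty Tt.
have [e e0 eB] := nbhs_line (b - x) xB.
pose t := Num.min (e / 2) 1.
have t0 : 0 < t by rewrite lt_min divr_gt0 ?ltr01.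
have te : t < e.
  by rewrite gt_min; apply/orP; left; rewrite ltr_pdivrMr// ltr_pMr// ltr1n.
have t1 : t <= 1 by rewrite ge_min lexx orbT.
exists (x + t *: (b - x)); split; last by apply: eB; rewrite gtr0_norm.
exists (fun i => (1 - t) * l i + t * m i); split.
- by move=> i iT; apply: ltr_wpDl; rewrite ?mulr_ge0 ?subr_ge0// mulr_gt0// m0.
- by move=> i iT; rewrite lT// mT// !mulr0 addr0.
- by rewrite big_split/= -!mulr_sumr l1 m1; ring.
- rewrite (_ : x + _ = (1 - t) *: x + t *: b); last first.
    by rewrite scalerBr scalerBl scale1r addrCA addrC.
  rewrite xE bE !scaler_sumr -big_split/=; apply: eq_bigr => i _.
  by rewrite !scalerA scalerDl.
Qed.

Lemma open_cell_finite_measure T : T \in tris M -> (mu2 (open_cell T) < +oo)%E.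
Proof.
move=> Tt; pose B : R := \sum_i (`|(p i).1| + `|(p i).2|).
have mB : measurable (`[- B, B] : set (measurableTypeR R)) by exact: measurable_itv.
apply: (@le_lt_trans _ _ (mu2 (`[- B, B] `*` `[- B, B]))); last first.
  rewrite product_measure1E//= lebesgue_measure_itv/=.
  by case: ifP => _ //=; rewrite ?mule0// -EFinD -EFinM ltry.
apply: le_measure; rewrite ?mem_set//.
- exact: measurable_open_cell.
- exact: measurableX.
move=> _ [l [l0 lT l1 ->]].
have l01 i : 0 <= l i <= 1.
  have ge0 m : 0 <= l m.
    by have [/l0/ltW//|/lT ->] := boolP (m \in T).
  by rewrite ge0 -l1 (bigD1 i)//= lerDl sumr_ge0.
have bound (f : R * R -> R) : (forall i, `|f (p i)| <= `|(p i).1| + `|(p i).2|) ->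
    `|\sum_i l i * f (p i)| <= B.
  move=> fB; apply: le_trans (ler_norm_sum _ _ _) _; apply: ler_sum => i _.
  have /andP[li0 li1] := l01 i.
  by rewrite normrM (ger0_norm li0); apply: le_trans (fB i); rewrite ler_piMl.
have fst_sum : (\sum_i l i *: p i).1 = \sum_i l i * (p i).1.
  by elim/big_rec2: _ => //= i y1 y2 _ <-.
have snd_sum : (\sum_i l i *: p i).2 = \sum_i l i * (p i).2.
  by elim/big_rec2: _ => //= i y1 y2 _ <-.
split => /=; rewrite in_itv/= -ler_norml ?fst_sum ?snd_sum.
  by apply: (bound fst) => i; rewrite lerDl.
by apply: (bound snd) => i; rewrite lerDr.
Qed.

Lemma edge_lines_null :
  measurable (edge_lines : set (measurableTypeR R * measurableTypeR R)) /\
  mu2 edge_lines = 0%E.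
Proof.
pose F (ij : 'I_N * 'I_N) := [set x | area2 (p ij.1) (p ij.2) x = 0].
have -> : edge_lines = \big[setU/set0]_(ij in [pred ij : 'I_N * 'I_N | ij.1 != ij.2]) F ij.
  rewrite -bigcup_pred; apply/seteqP; split => x.
    by move=> [i [j [ij x0]]]; exists (i, j).
  by move=> [[i j] /= ij x0]; exists i, j.
elim/big_ind : _ => [|A B [mA A0] [mB B0]|[i j] /= ij].
- by split; [exact: measurable0|exact: measure0].
- split; first exact: measurableU.
  by rewrite measureU0.
have FE : F (i, j) = [set x | ((p i).2 - (p j).2) * x.1 + ((p j).1 - (p i).1) * x.2 +
    ((p i).1 * (p j).2 - (p i).2 * (p j).1) = 0].
  by apply/seteqP; split => x /=; rewrite /F /= area2_affine.
rewrite FE; split; first exact: measurable_line.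
apply: plane_measure_line; rewrite -negb_and !subr_eq0.
apply: contra ij => /andP[/eqP h2 /eqP h1]; apply/eqP/node_inj.
by move: h1 h2; case: (p i) (p j) => ? ? [? ?] /= -> ->.
Qed.

End Triangulation.
End Triangles.

(** * The energy form *)

Section EnergyForm.
Context {R : realType}.
Variables (M : mesh R) (Omega : set (R * R)).
Local Notation N := (nb_nodes M).
Local Notation p := (@node R M).
Local Notation fct := (R * R -> R).
Local Notation mu2 := (@lebesgue_measure R \x @lebesgue_measure R)%E.
Local Notation plane := (measurableTypeR R * measurableTypeR R)%type.
Implicit Types (T : {set 'I_N}) (x y z g : R * R) (u v w : fct) (D : set (R * R)).

(** Exact affine agreement near [x], with gradient [g]: the difference quotients at [x] are then
    eventually constant. *)
Definition locally_affine u x g := \forall y \near x, u y = u x + dot g (y - x).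

Lemma dot_delta x (h : R) (v : R * R) g : dot g (h *: v + x - x) = h * dot g v.
Proof. by rewrite addrK /dot /= /GRing.scale /=; ring. Qed.

Lemma derive_locally_affine u x g (v : R * R) : locally_affine u x g -> 'D_v u x = dot g v.
Proof.
move=> ug; rewrite /derive; apply: cvg_lim => //.
apply: cvg_near_cst.
have : (fun h : R => h *: v + x) @ 0^' --> x.
  rewrite -[X in _ --> X]add0r -(scale0r v).
  apply: cvgD; last exact: cvg_cst.
  by apply: cvgZl; exact: (cvg_within_filter _ (@cvg_id _ _)).
move=> /(_ _ ug) ugx.
near=> h.
have h0 : h != 0 by near: h; exact: nbhs_dnbhs_neq.
have -> : (u \o shift x) (h *: v) = u x + dot g (h *: v + x - x).
  by rewrite /=; near: h.
by rewrite dot_delta addrAC subrr add0r /GRing.scale /= mulrA mulVf// mul1r.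
Unshelve. all: by end_near. Qed.

Lemma grad_locally_affine u x g : locally_affine u x g -> grad u x = g.
Proof.
move=> ug; rewrite /grad !(derive_locally_affine _ ug) /dot /= !(mulr1, mulr0).
by rewrite addr0 add0r; case: g {ug}.
Qed.

Lemma locally_affine_lin (a : R) u v x g h : locally_affine u x g ->
  locally_affine v x h -> locally_affine (a *: u + v) x (a *: g + h).
Proof.
move=> ug vh; near=> y.
rewrite !fctE /= (near ug y)// (near vh y)//.
by rewrite /dot /GRing.scale /= /GRing.scale /=; ring.
Unshelve. all: by end_near. Qed.

Hypothesis tri : triangulation Omega M.

(** The last clause makes [D], up to the edge lines, a union of open triangles, so that integrals
    over [D] become finite sums. *)
Definition mesh_adapted D :=
  [/\ open D, D `<=` Omega &
   forall T, T \in tris M -> open_cell T `&` D !=set0 -> open_cell T `<=` D].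

Lemma Wsub_locally_affine D T w : T \in tris M -> open_cell T `<=` D ->
  Wsub M Omega D w -> exists g, forall x, open_cell T x -> locally_affine w x g.
Proof.
move=> Tt TD [w0 [cw w0O w0T] <-].
have [a [b [c wE]]] := w0T _ Tt; exists (b, c) => x Tx.
have E y : open_cell T y -> (w0 \_ (closure D)) y = a + b * y.1 + c * y.2.
  move=> Ty; rewrite patchE mem_set ?wE//; first exact: open_cell_sub.
  exact/subset_closure/TD.
near=> y.
rewrite (E y); last by near: y; exact: (open_cell_nbhs tri).
by rewrite E// /dot /=; ring.
Unshelve. all: by end_near. Qed.

Lemma closure_covered x : closure Omega x -> ~ edge_lines M x ->
  exists2 T, T \in tris M & open_cell T x.
Proof.
move=> Ox xN; have [_ cov _ _] := tri.
move: Ox; rewrite -cov => -[T /= Tt Tx]; exists T => //.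
exact: (cell_open_cell tri).
Qed.

Definition cell_point T : R * R := xget 0 (open_cell T).

Lemma cell_pointP T : T \in tris M -> open_cell T (cell_point T).
Proof. by move=> /(open_cell_nonempty tri); exact: xgetPex. Qed.

(** Gradients are sampled at one point, as they are constant on an open triangle contained in
    [D]. *)
Definition cell_energy D u v T : R :=
  if `[< open_cell T `<=` D >]
  then dot (grad u (cell_point T)) (grad v (cell_point T)) else 0.

Lemma integrandE D u v x : mesh_adapted D -> Wsub M Omega D u -> Wsub M Omega D v ->
  ~ edge_lines M x ->
  ((fun x => dot (grad u x) (grad v x)) \_ D) x =
  \sum_(T in tris M) cell_energy D u v T * \1_(open_cell T) x.
Proof.
move=> [oD DO aD] Wu Wv xN; rewrite patchE.
have [/set_mem Dx|/negP Dx] := boolP (x \in D).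
  have [T Tt Tx] := closure_covered (subset_closure (DO _ Dx)) xN.
  have TD : open_cell T `<=` D by apply: aD => //; exists x.
  rewrite (bigD1 T)//= big1 => [|T' /andP[Tt' TT']].
    have [g ug] := Wsub_locally_affine Tt TD Wu.
    have [h vh] := Wsub_locally_affine Tt TD Wv.
    have Tc := cell_pointP Tt.
    rewrite indicE mem_set// mulr1 addr0 /cell_energy asboolT//.
    rewrite (grad_locally_affine (ug _ Tx)) (grad_locally_affine (vh _ Tx)).
    by rewrite (grad_locally_affine (ug _ Tc)) (grad_locally_affine (vh _ Tc)).
  rewrite indicE memNset ?mulr0// => Tx'.
  move/eqP: TT'; apply; apply: (cell_unique tri Tt' Tt _ _ xN); exact: open_cell_sub.
rewrite big1// => T Tt; rewrite indicE /cell_energy.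
case: asboolP => TD; last by rewrite mul0r.
by rewrite memNset ?mulr0// => Tx; apply: Dx; rewrite mem_set//; exact: TD.
Qed.

Lemma integrable_cell (k : R) T : T \in tris M ->
  mu2.-integrable setT (fun x : plane => (k * \1_(open_cell T) x)%:E).
Proof.
move=> Tt; have mT := measurable_open_cell tri Tt.
under eq_fun do rewrite EFinM.
apply: integrableZl => //; apply/integrableP; split; first exact/measurable_EFinP.
rewrite (eq_integral (fun x : plane => (\1_(open_cell T) x)%:E)); last first.
  by move=> x _; rewrite gee0_abs// lee_fin.
by rewrite integral_indic// setIT; exact: (open_cell_finite_measure tri).
Qed.

(** Extended by zero to sets of nodes that are not mesh triangles, so that every index of the sum
    has an integrable term. *)
Let cell_fun (k : {set 'I_N} -> R) T (x : plane) : \bar R :=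
  if T \in tris M then (k T * \1_(open_cell T) x)%:E else 0%E.

Let cell_funE k (x : plane) :
  (\sum_(T in tris M) k T * \1_(open_cell T) x)%:E = (\sum_T cell_fun k T x)%E.
Proof. by rewrite /cell_fun -big_mkcond sumEFin. Qed.

Let integrable_cell_fun k T : mu2.-integrable setT (cell_fun k T).
Proof.
rewrite /cell_fun; case: (boolP (T \in tris M)) => Tt.
  exact: integrable_cell.
exact: integrable0.
Qed.

Lemma integrable_cells (k : {set 'I_N} -> R) :
  mu2.-integrable setT
    (fun x : plane => (\sum_(T in tris M) k T * \1_(open_cell T) x)%:E).
Proof.
under eq_fun do rewrite cell_funE.
by apply: integrable_sum => // T _; exact: integrable_cell_fun.
Qed.

Definition cell_area T : R := fine (mu2 (open_cell T)).

Lemma integral_cells (k : {set 'I_N} -> R) :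
  (\int[mu2]_x (\sum_(T in tris M) k T * \1_(open_cell T) x)%:E =
   (\sum_(T in tris M) k T * cell_area T)%:E)%E.
Proof.
under eq_integral do rewrite cell_funE.
rewrite (integral_sum measurableT (integrable_cell_fun k)).
rewrite -sumEFin [RHS]big_mkcond; apply: eq_bigr => T _.
rewrite /cell_fun; case: (boolP (T \in tris M)) => Tt; last by rewrite integral0.
have mT := measurable_open_cell tri Tt.
under eq_integral do rewrite EFinM.
rewrite integralZl//; last first.
  have := integrable_cell 1 Tt; apply: eq_integrable => // x _ /=.
  by rewrite mul1r.
rewrite integral_indic// setIT EFinM /cell_area fineK//.
rewrite ge0_fin_numE//; exact: (open_cell_finite_measure tri).
Qed.

(** Off a null set the integrand is a step function on the open triangles. The resulting finite sum
    reduces the linearity and scaling of the energy to algebra. *)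
Lemma aformE D nu u v : mesh_adapted D -> Wsub M Omega D u -> Wsub M Omega D v ->
  aform D nu u v = nu * \sum_(T in tris M) cell_energy D u v T * cell_area T.
Proof.
move=> aD Wu Wv; rewrite /aform /Rintegral integral_mkcond.
have [mN N0] := edge_lines_null tri.
rewrite (integral_eq_off_null mN N0 (g := fun x : plane =>
  (\sum_(T in tris M) (nu * cell_energy D u v T) * \1_(open_cell T) x)%:E)).
  by rewrite integral_cells /= mulr_sumr; apply: eq_bigr => T _; rewrite mulrA.
move=> x xN; rewrite restrict_EFin; congr (_%:E).
under eq_bigr do rewrite -mulrA.
rewrite -mulr_sumr -(integrandE aD Wu Wv xN) !patchE.
by case: ifP; rewrite ?mulr0.
Qed.

Lemma dotC g h : dot g h = dot h g.
Proof. by rewrite /dot mulrC [_ * h.2]mulrC. Qed.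

Lemma aformC D nu u v : aform D nu u v = aform D nu v u.
Proof. by apply: eq_Rintegral => x _; rewrite dotC. Qed.

Lemma aform_ge0 D nu u : 0 <= nu -> 0 <= aform D nu u u.
Proof.
move=> nu0; apply: Rintegral_ge0 => x _; apply: mulr_ge0 => //.
by rewrite /dot addr_ge0// -expr2 sqr_ge0.
Qed.

Lemma aform_nu D nu u v : mesh_adapted D -> Wsub M Omega D u -> Wsub M Omega D v ->
  aform D nu u v = nu * aform D 1 u v.
Proof. by move=> aD Wu Wv; rewrite !aformE// mul1r. Qed.

Lemma W_subspace : subspace (W M Omega).
Proof.
split.
  split => //; first by move=> x; exact: cvg_cst.
  by move=> T _; exists 0, 0, 0 => x _; rewrite !mul0r !addr0.
move=> a u v [cu uO uT] [cv vO vT]; split.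
- move=> x; apply: cvgD; last exact: cv.
  by apply: cvgM; [exact: cvg_cst|exact: cu].
- by move=> x xO; rewrite !fctE /= uO// vO// scaler0 addr0.
- move=> T Tt; have [a1 [b1 [c1 uE]]] := uT _ Tt; have [a2 [b2 [c2 vE]]] := vT _ Tt.
  exists (a * a1 + a2), (a * b1 + b2), (a * c1 + c2) => x Tx.
  by rewrite !fctE /= uE// vE// /GRing.scale /=; ring.
Qed.

Lemma restrict_lin (A : set (R * R)) (a : R) u v :
  (a *: u + v) \_ A = a *: (u \_ A) + v \_ A.
Proof.
apply/funext => x; rewrite !fctE !patchE; case: ifP => //= _.
by rewrite scaler0 addr0.
Qed.

Lemma restriction_subspace (A : set (R * R)) : subspace [set w \_ A | w in W M Omega].
Proof.
have [W0 Wlin] := W_subspace; split.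
  exists 0 => //; apply/funext => x; rewrite patchE; case: ifP => //.
move=> a _ _ [u Wu <-] [v Wv <-]; exists (a *: u + v); first exact: Wlin.
exact: restrict_lin.
Qed.

Lemma aform_lin D nu (a : R) u v w : mesh_adapted D -> Wsub M Omega D u ->
  Wsub M Omega D v -> Wsub M Omega D w ->
  aform D nu (a *: u + v) w = a * aform D nu u w + aform D nu v w.
Proof.
move=> aD Wu Wv Ww; have Wuv := (restriction_subspace (closure D)).2 a _ _ Wu Wv.
rewrite !aformE// mulrCA -mulrDr; congr (_ * _).
rewrite mulr_sumr -big_split /=; apply: eq_bigr => T Tt.
rewrite mulrA -mulrDl; congr (_ * _); rewrite /cell_energy.
case: asboolP => TD; last by rewrite mulr0 addr0.
have [g ug] := Wsub_locally_affine Tt TD Wu.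
have [h vh] := Wsub_locally_affine Tt TD Wv.
have Tc := cell_pointP Tt.
rewrite (grad_locally_affine (locally_affine_lin a (ug _ Tc) (vh _ Tc))).
rewrite (grad_locally_affine (ug _ Tc)) (grad_locally_affine (vh _ Tc)).
by rewrite /dot /= /GRing.scale /=; ring.
Qed.

(* Cauchy-Schwarz: a vector of zero energy is in the kernel of the form. *)
Lemma aform_eq0 D nu u v : 0 <= nu -> mesh_adapted D -> Wsub M Omega D u ->
  Wsub M Omega D v -> aform D nu u u = 0 -> aform D nu u v = 0.
Proof.
move=> nu0 aD Wu Wv u0.
set b := aform D nu u v; set c := aform D nu v v.
have c0 : 0 <= c by exact: aform_ge0.
have quad t : 0 <= 2 * t * b + c.
  have Wuv := (restriction_subspace (closure D)).2 t _ _ Wu Wv.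
  have := aform_ge0 D (t *: u + v) nu0.
  rewrite (aform_lin nu t aD Wu Wv Wuv) (aformC D nu u) (aformC D nu v (_ + _)).
  rewrite (aform_lin nu t aD Wu Wv Wu) (aform_lin nu t aD Wu Wv Wv) u0.
  by rewrite (aformC D nu v u) -/b -/c; lra.
apply: contrapT => /eqP b0.
(* At this value of [t] the nonnegative affine function would equal -1. *)
have := quad (- (c + 1) / (2 * b)).
by rewrite (_ : 2 * _ * b = - (c + 1)); [lra|field].
Qed.

End EnergyForm.

(** * Mirror symmetry *)

Section Mirror.
Context {R : realType}.
Variables (o n : R * R).
Hypothesis n1 : dot n n = 1.
Local Notation rho := (reflection o n).
Implicit Types (x y : R * R) (A B : set (R * R)).

(** Signed distance to the line of symmetry. *)
Definition height x := dot (x - o) n.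

Lemma height_reflection x : height (rho x) = - height x.
Proof.
have -> : height (rho x) = height x - 2 * height x * dot n n.
  by rewrite /height /reflection /dot /= /GRing.scale /=; ring.
by rewrite n1; ring.
Qed.

Lemma reflectionK x : rho (rho x) = x.
Proof.
have -> : rho (rho x) = rho x - (2 * height (rho x)) *: n by [].
rewrite height_reflection /reflection -/(height x) mulrN scaleNr opprK.
by rewrite subrK.
Qed.

Lemma reflection_fixed x : height x = 0 -> rho x = x.
Proof. by move=> x0; rewrite /reflection -/(height x) x0 mulr0 scale0r subr0. Qed.

Lemma reflection_continuous : continuous rho.
Proof.
move=> x.
have E : rho = fun y =>
    ((1 - 2 * n.1 * n.1) * y.1 + - (2 * n.2 * n.1) * y.2 + 2 * n.1 * (o.1 * n.1 + o.2 * n.2),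
     - (2 * n.1 * n.2) * y.1 + (1 - 2 * n.2 * n.2) * y.2 + 2 * n.2 * (o.1 * n.1 + o.2 * n.2)).
  by apply/funext => y; rewrite reflectionE; congr pair; ring.
by rewrite E; apply: (@cvg_pair _ _ _ _ (nbhs _) (nbhs _));
  exact: continuous_affine2.
Qed.

Lemma nbhs_reflection x A : nbhs (rho x) A -> nbhs x (rho @^-1` A).
Proof. exact: reflection_continuous. Qed.

Lemma closure_reflection A : closure (rho @^-1` A) = rho @^-1` closure A.
Proof.
have sub B : rho @^-1` closure B `<=` closure (rho @^-1` B).
  move=> x /= Bx C xC.
  have [] := Bx (rho @^-1` C); first by apply: nbhs_reflection; rewrite reflectionK.
  by move=> y [By Cy]; exists (rho y); split=> //; rewrite /= reflectionK.
apply/seteqP; split => // x; rewrite -{1}(reflectionK x) => /(sub _).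
by congr (closure _ _); apply/funext => y /=; rewrite reflectionK.
Qed.

Lemma interior_reflection A : interior (rho @^-1` A) = rho @^-1` interior A.
Proof.
have sub B : rho @^-1` interior B `<=` interior (rho @^-1` B).
  by move=> x /=; exact: nbhs_reflection.
apply/seteqP; split => // x; rewrite -{1}(reflectionK x) => /(sub _).
by congr (interior _ _); apply/funext => y /=; rewrite reflectionK.
Qed.

Lemma boundary_reflection A : boundary (rho @^-1` A) = rho @^-1` boundary A.
Proof. by rewrite /boundary closure_reflection interior_reflection. Qed.

Lemma image_reflection A : rho @` A = rho @^-1` A.
Proof.
apply/seteqP; split => [_ [x Ax <-]|x Ax] /=; first by rewrite reflectionK.
by exists (rho x) => //; rewrite reflectionK.
Qed.

Variables (Omega Omega1 Omega2 : set (R * R)).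
Hypothesis dec : decomposition Omega Omega1 Omega2.
Hypothesis mir : mirror_domains o n Omega1 Omega2.
Local Notation Gamma := (interface Omega1 Omega2).

Lemma Omega2E : Omega2 = rho @^-1` Omega1.
Proof. by case: mir => _ _ <-; exact: image_reflection. Qed.

Lemma Omega1E : Omega1 = rho @^-1` Omega2.
Proof. by rewrite Omega2E; apply/funext => x /=; rewrite reflectionK. Qed.

Lemma interface_height x : Gamma x -> height x = 0.
Proof. by case: mir => _ + _; apply. Qed.

Lemma interface_fixed x : Gamma x -> rho x = x.
Proof. by move=> /interface_height; exact: reflection_fixed. Qed.

(** A point of [Omega1] on the line of symmetry would be its own mirror image, hence also in the
    disjoint [Omega2]. *)
Lemma Omega1_height x : Omega1 x -> height x != 0.
Proof.
move=> Ox; apply/eqP => /reflection_fixed xE.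
have : (Omega1 `&` Omega2) x by split=> //; rewrite Omega2E /= xE.
by case: dec => _ _ ->.
Qed.

Lemma Omega2_height x : Omega2 x -> height x != 0.
Proof. by rewrite Omega2E => /Omega1_height; rewrite height_reflection oppr_eq0. Qed.

Lemma Omega_split x : Omega x -> [\/ Omega1 x, Omega2 x | Gamma x].
Proof.
move=> Ox; have [Gx|Gx] := pselect (Gamma x); first by constructor 3.
have : (Omega `\` Gamma) x by [].
by case: dec => _ _ _ <- [?|?]; [constructor 1|constructor 2].
Qed.

Lemma Omega1_sub : Omega1 `<=` Omega.
Proof.
case: dec => _ _ _ E x Ox; have : (Omega1 `|` Omega2) x by left.
by rewrite E => -[].
Qed.

Lemma Omega2_sub : Omega2 `<=` Omega.
Proof.
case: dec => _ _ _ E x Ox; have : (Omega1 `|` Omega2) x by right.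
by rewrite E => -[].
Qed.

Lemma interface_of_height x : Omega x -> height x = 0 -> Gamma x.
Proof.
move=> /Omega_split[/Omega1_height|/Omega2_height|//] h0 h;
by rewrite h eqxx in h0.
Qed.

Lemma Omega_reflection : rho @^-1` Omega = Omega.
Proof.
have sub x : Omega x -> Omega (rho x).
  move=> Ox; have [Ox1|Ox2|Gx] := Omega_split Ox.
  - by apply: Omega2_sub; rewrite Omega2E /= reflectionK.
  - by apply: Omega1_sub; rewrite Omega1E /= reflectionK.
  - by rewrite (interface_fixed Gx).
by apply/seteqP; split => x /= /sub; rewrite ?reflectionK.
Qed.

Variables (M : mesh R).
Local Notation N := (nb_nodes M).
Hypothesis tri : triangulation Omega M.
Hypothesis cut : cuts_no_element Gamma M.
Implicit Types (T : {set 'I_N}).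

Lemma open_cell_interior T : T \in tris M -> open_cell T `<=` interior (cell T).
Proof.
move=> Tt x Tx; have := open_cell_nbhs tri Tt Tx.
by apply: filterS; exact: open_cell_sub.
Qed.

Lemma open_cell_interface T x : T \in tris M -> open_cell T x -> ~ Gamma x.
Proof.
move=> Tt Tx Gx; have : (interior (cell T) `&` Gamma) x.
  by split=> //; exact: open_cell_interior.
by rewrite cut.
Qed.

Lemma open_cell_Omega T x : T \in tris M -> open_cell T x -> Omega1 x \/ Omega2 x.
Proof.
move=> Tt Tx; have Ox : Omega x.
  by have [_ _ /(_ _ Tt)[_ _ +] _] := tri; apply; exact: open_cell_interior.
have [?|?|Gx] := Omega_split Ox; [by left|by right|].
by have := open_cell_interface Tt Tx.
Qed.

Lemma open_Omega1 : open Omega1. Proof. by case: dec => -[]. Qed.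
Lemma open_Omega2 : open Omega2. Proof. by case: dec => _ []. Qed.

(* An open triangle is convex and avoids the interface, so it cannot meet both
   subdomains. *)
Lemma open_cell_one_side T x y : T \in tris M -> open_cell T x -> open_cell T y ->
  Omega1 x -> Omega2 y -> False.
Proof.
move=> Tt Tx Ty Ox Oy.
have disj z : Omega1 z -> Omega2 z -> False.
  by move=> z1 z2; have : (Omega1 `&` Omega2) z by []; case: dec => _ _ ->.
pose gam (t : R) : R * R := (1 - t) *: x + t *: y.
have cgam : continuous gam.
  move=> t; apply: cvgD; apply: cvgZl; last exact: cvg_id.
  by apply: cvgB; [exact: cvg_cst|exact: cvg_id].
have Tgam t : t \in `[0, 1] -> open_cell T (gam t).
  by rewrite in_itv/= => /andP[t0 t1]; exact: open_cell_convex.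
(* Along the segment, the part in [Omega1] is open, and closed as the complement of the part in
   [Omega2]; connectedness makes it everything. *)
have : `[0, 1]%classic `&` gam @^-1` Omega1 = `[0, 1]%classic.
  apply: (@segment_connected R 0 1).
  - exists 0; split; first by rewrite /= in_itv/= lexx ler01.
    by rewrite /= /gam subr0 scale1r scale0r addr0.
  - exists (gam @^-1` Omega1) => //.
    by apply: open_comp; [move=> t _; exact: cgam|exact: open_Omega1].
  - exists (~` (gam @^-1` Omega2)).
      apply: open_closedC; apply: open_comp; last exact: open_Omega2.
      by move=> t _; exact: cgam.
    apply/seteqP; split => t [t01 tO]; split => //=.
      by move=> /(disj _ tO).
    by have [] := open_cell_Omega Tt (Tgam _ t01).
move=> /seteqP[_ /(_ 1)[]]; first by rewrite /= in_itv/= lexx ler01.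
by rewrite /= /gam subrr scale0r scale1r add0r => _ /disj; apply.
Qed.

Lemma mesh_adapted1 : mesh_adapted M Omega Omega1.
Proof.
split; [exact: open_Omega1|exact: Omega1_sub|].
move=> T Tt [x [Tx Ox]] y Ty.
have [//|Oy] := open_cell_Omega Tt Ty.
by have := open_cell_one_side Tt Tx Ty Ox Oy.
Qed.

Lemma mesh_adapted2 : mesh_adapted M Omega Omega2.
Proof.
split; [exact: open_Omega2|exact: Omega2_sub|].
move=> T Tt [x [Tx Ox]] y Ty.
have [Oy|//] := open_cell_Omega Tt Ty.
by have := open_cell_one_side Tt Ty Tx Oy Ox.
Qed.

Lemma cell_boundary_edge T x : T \in tris M -> cell T x -> ~ open_cell T x ->
  exists j k, [/\ j != k, j \in T, k \in T & cell [set j; k]%SET x].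
Proof.
move=> Tt [l [l0 lT l1 xE]] xN.
have [i iT li] : exists2 i, i \in T & l i = 0.
  apply: contrapT => nex; apply: xN; exists l; split => // i iT.
  by rewrite lt_neqAle l0 andbT eq_sym; apply/eqP => li; apply: nex; exists i.
have [_ _ /(_ _ Tt)[T3 _ _] _] := tri.
have [j [k [ij ik jk TE]]] := set3_of_mem T3 iT.
exists j, k; split => //; rewrite ?TE ?finset.inE ?eqxx ?orbT//.
exists l; split => // m mjk.
have [->//|mi] := eqVneq m i.
by apply: lT; rewrite TE -finset.setUA finset.in_setU1 negb_or mi.
Qed.

(** A point on the line is fixed by the reflection, so it is in both closures as soon as it is in
    one; it is interior to neither subdomain since both avoid the line. *)
Lemma closure_interface z : closure Omega1 z \/ closure Omega2 z ->
  height z = 0 -> Gamma z.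
Proof.
move=> cz hz; have zz := reflection_fixed hz.
have c12 : closure Omega1 z <-> closure Omega2 z.
  by rewrite Omega2E closure_reflection /= zz.
have [c1 c2] : closure Omega1 z /\ closure Omega2 z.
  by case: cz => c; split => //; apply/c12.
split; split => // /interior_subset.
  by move=> /Omega1_height; rewrite hz eqxx.
by move=> /Omega2_height; rewrite hz eqxx.
Qed.

Lemma height_segment (a b : R * R) (s : R) :
  height ((1 - s) *: a + s *: b) = (1 - s) * height a + s * height b.
Proof. by rewrite /height /dot /= /GRing.scale /=; ring. Qed.

(* Points of the interface near [x] lie on finitely many mesh edges, and an
   edge containing two of them is contained in the line of symmetry. *)
Lemma interface_dense x B : open Omega -> Omega x -> Gamma x -> nbhs x B ->
  exists (i j : 'I_N) y, [/\ i != j, interface_edge Omega1 Omega2 i j,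
    cell [set i; j]%SET y & B y].
Proof.
move=> oO Ox Gx xB.
have hx := interface_height Gx.
pose d : R * R := (- n.2, n.1).
have hd s : height (x + s *: d) = 0.
  by rewrite -[RHS]hx /height /dot /= /GRing.scale /=; ring.
have dn0 : d != 0.
  apply/eqP => -[] /eqP; rewrite oppr_eq0 => /eqP n20 n10.
  by move: n1; rewrite /dot n20 n10 !mul0r addr0 => /eqP; rewrite eq_sym oner_eq0.
have [e e0 eB] : exists2 e, 0 < e & forall t, `|t| < e -> (B `&` Omega) (x + t *: d).
  apply: nbhs_line; apply: filterI => //.
  exact: oO.
(* Pigeonhole: among [K.+1] distinct points of the line, two get the same pair of nodes out of [K].
   The denominators [m.+2] keep each [t m] strictly below [e]. *)
pose K := #|{: 'I_N * 'I_N}|.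
pose t (m : 'I_K.+1) : R := e / m.+2%:R.
have te m : `|t m| < e.
  rewrite gtr0_norm ?divr_gt0// ltr_pdivrMr ?ltr0n// ltr_pMr// ltr1n//.
pose y m := x + t m *: d.
have edge m : exists jk : 'I_N * 'I_N, [/\ jk.1 != jk.2, cell [set jk.1; jk.2]%SET (y m) &
    exists2 T, T \in tris M & jk.1 \in T /\ jk.2 \in T].
  have [_ Oy] := eB _ (te m).
  have : closure Omega (y m) by exact: subset_closure.
  have [_ <- _ _] := tri.
  move=> [T /= Tt Ty].
  have [|j [k [jk jT kT yjk]]] := cell_boundary_edge Tt Ty.
    by move=> /(open_cell_interface Tt); apply; apply: interface_of_height => //; exact: hd.
  by exists (j, k); split => //; exists T.
pose g m := projT1 (cid (edge m)).
have gP m : [/\ (g m).1 != (g m).2, cell [set (g m).1; (g m).2]%SET (y m) &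
    exists2 T, T \in tris M & (g m).1 \in T /\ (g m).2 \in T].
  exact: projT2 (cid (edge m)).
have [m [m' [mm' gg]]] : exists m m', m != m' /\ g m = g m'.
  apply: contrapT => ninj.
  have /leq_card : injective g.
    move=> m m' gg; apply: contrapT => /eqP mm'; apply: ninj.
    by exists m, m'.
  by rewrite card_ord ltnn.
have [jk ym [T Tt [jT kT]]] := gP m; have [_ ym' _] := gP m'.
rewrite -gg in ym'; move: jk ym ym' jT kT; case: (g m) => j k /= jk ym ym' jT kT.
exists j, k, (y m); split => //; last by have [] := eB _ (te m).
split.
  by exists T => //; apply/fintype.subsetP => q /set_mem[] ->.
move: ym ym'; rewrite !cell2P// => -[s _ sE] [s' _ s'E].
have ss' : s' != s.
  apply/eqP => ss; move: sE; rewrite -ss s'E => /eqP; rewrite /y.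
  rewrite (inj_eq (addrI x)) -subr_eq0 -scalerBl scaler_eq0 (negPf dn0) orbF subr_eq0.
  move=> /eqP /(mulfI (lt0r_neq0 e0)) /invr_inj /eqP.
  by rewrite eqr_nat !eqSS; apply/negP; rewrite eq_sym.
have : height (y m) = 0 by exact: hd.
have : height (y m') = 0 by exact: hd.
rewrite -sE -s'E !height_segment.
set hj := height (node j); set hk := height (node k) => h' h.
(* The height is affine along the edge and vanishes at two distinct parameters, so it vanishes on
   the whole edge. *)
have hjk : hk = hj.
  have /eqP : (s' - s) * (hk - hj) = 0 by lra.
  by rewrite mulf_eq0 subr_eq0 (negPf ss')/= subr_eq0 => /eqP.
have hj0 : hj = 0 by rewrite hjk in h; lra.
move=> z zjk; apply: closure_interface.
  have cT : closure (open_cell T) z.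
    apply: (cell_sub_closure tri) => //; apply: cell_sub zjk.
    by apply/fintype.subsetP => q; rewrite !finset.inE => /orP[] /eqP ->.
  have [b Tb] := open_cell_nonempty tri Tt.
  have [_ _ a1] := mesh_adapted1; have [_ _ a2] := mesh_adapted2.
  have [Ob|Ob] := open_cell_Omega Tt Tb; [left|right];
    by apply: closure_subset cT; first [apply: a1|apply: a2] => //; exists b.
move: zjk; rewrite cell2P// => -[r _ <-]; rewrite height_segment.
by rewrite -/hj -/hk hjk hj0 !mulr0 addr0.
Qed.

End Mirror.

(** * The product on the interface *)

Section InterfaceForm.
Context {R : realType}.
Variables (M : mesh R) (Omega Omega1 Omega2 : set (R * R)).
Local Notation N := (nb_nodes M).
Local Notation p := (@node R M).
Local Notation fct := (R * R -> R).
Local Notation lambda := (@lebesgue_measure R).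
Local Notation Gamma := (interface Omega1 Omega2).
Local Notation V := (VGamma M Omega Omega1 Omega2).
Local Notation ip := (ip_Gamma M Omega1 Omega2).
Implicit Types (u v w : fct) (i j : 'I_N).

Let seg i j (t : R) : R * R := (1 - t) *: p i + t *: p j.

Lemma seg_continuous i j : continuous (seg i j).
Proof.
move=> t; apply: cvgD; apply: cvgZl; last exact: cvg_id.
by apply: cvgB; [exact: cvg_cst|exact: cvg_id].
Qed.

Lemma interface_edge_seg i j t : i != j -> interface_edge Omega1 Omega2 i j ->
  t \in `[0, 1] -> Gamma (seg i j t).
Proof. by move=> ij [_ +] t01; apply; apply/cell2P => //; exists t. Qed.

(** A trace is cut off outside [Gamma] and need not be continuous in the plane; along an interface
    edge it agrees with a continuous function, which supplies integrability. *)
Lemma trace_continuous i j u : i != j -> interface_edge Omega1 Omega2 i j -> V u ->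
  exists2 f : R -> R, continuous f & forall t, t \in `[0, 1] -> u (seg i j t) = f t.
Proof.
move=> ij eij [w [cw _ _] <-]; exists (w \o seg i j).
  by move=> t; apply: continuous_comp; [exact: seg_continuous|exact: cw].
by move=> t t01; rewrite patchE mem_set//; exact: interface_edge_seg.
Qed.

Lemma continuous_integrable01 (f : R -> R) : continuous f ->
  lambda.-integrable `[0, 1] (EFin \o f).
Proof.
move=> cf; apply: (@continuous_compact_integrable R f); first exact: segment_compact.
by apply: continuous_subspaceT.
Qed.

Lemma edge_integral_lin i j (a : R) u v w : i != j ->
  interface_edge Omega1 Omega2 i j -> V u -> V v -> V w ->
  edge_integral (p i) (p j) (fun x => (a *: u + v) x * w x) =
  a * edge_integral (p i) (p j) (fun x => u x * w x) +
  edge_integral (p i) (p j) (fun x => v x * w x).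
Proof.
move=> ij eij Vu Vv Vw; rewrite /edge_integral mulrCA -mulrDr; congr (_ * _).
have [fu cu uE] := trace_continuous ij eij Vu.
have [fv cv vE] := trace_continuous ij eij Vv.
have [fw cw wE] := trace_continuous ij eij Vw.
have cuw : continuous (fun t => fu t * fw t).
  by move=> t; apply: cvgM; [exact: cu|exact: cw].
have cvw : continuous (fun t => fv t * fw t).
  by move=> t; apply: cvgM; [exact: cv|exact: cw].
have cauw : continuous (fun t => a * (fu t * fw t)).
  by move=> t; apply: cvgM; [exact: cvg_cst|exact: cuw].
transitivity (\int[lambda]_(t in `[0, 1]) (a * (fu t * fw t) + fv t * fw t)).
  apply: eq_Rintegral => t /set_mem t01; rewrite -/(seg i j t) -uE// -vE// -wE//.
  by rewrite !fctE /GRing.scale /= mulrDl mulrA.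
rewrite RintegralD//; [|exact: continuous_integrable01..].
rewrite RintegralZl//; last exact: continuous_integrable01.
congr (_ * _ + _); apply: eq_Rintegral => t /set_mem t01.
  by rewrite -/(seg i j t) -uE// -wE.
by rewrite -/(seg i j t) -vE// -wE.
Qed.

Lemma ip_Gamma_lin (a : R) u v w : V u -> V v -> V w ->
  ip (a *: u + v) w = a * ip u w + ip v w.
Proof.
move=> Vu Vv Vw; rewrite /ip_Gamma mulr_sumr -big_split /=.
apply: eq_bigr => i _; rewrite mulr_sumr -big_split /=.
apply: eq_bigr => j /andP[ij /asboolP eij].
by apply: edge_integral_lin => //; apply: contraTneq ij => ->; rewrite ltnn.
Qed.

Lemma ip_GammaC u v : ip u v = ip v u.
Proof.
apply: eq_bigr => i _; apply: eq_bigr => j _; congr (_ * _).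
by apply: eq_Rintegral => t _; rewrite mulrC.
Qed.

(** If [f t > 0], then [f] exceeds [f t / 2] on an interval of positive length inside the unit
    interval, and the integral is positive. *)
Lemma continuous_integral_eq0 (f : R -> R) : continuous f -> (forall t, 0 <= f t) ->
  \int[lambda]_(t in `[0, 1]) f t = 0 -> forall t, t \in `[0, 1] -> f t = 0.
Proof.
move=> cf f0 int0 t t01; apply: contrapT => /eqP ft.
have ft0 : 0 < f t by rewrite lt_neqAle eq_sym ft f0.
have /nbhs_ballP[e /= e0 eB] : \forall s \near t, f t / 2 < f s.
  by move: (cf t) => /cvgr_gt; apply; rewrite ltr_pdivrMr// ltr_pMr// ltr1n.
move: t01; rewrite in_itv/= => /andP[t0 t1].
pose a := Num.max 0 (t - e / 2); pose b := Num.min 1 (t + e / 2).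
have e2 : 0 < e / 2 by rewrite divr_gt0.
have ab : a < b.
  by rewrite lt_min !gt_max; apply/andP; split; apply/andP; split; lra.
have aE : 0 <= a /\ t - e / 2 <= a by rewrite !le_max !lexx orbT.
have bE : b <= 1 /\ b <= t + e / 2 by rewrite !ge_min !lexx orbT.
have sub : `[a, b]%classic `<=` `[0, 1]%classic.
  by move=> s; rewrite /= !in_itv/=; lra.
have intE : (\int[lambda]_(s in `[0%R, 1%R]) (f s)%:E = 0)%E.
  rewrite -[LHS]fineK ?[fine _]int0//; exact/integrable_fin_num/continuous_integrable01.
have mf (A : set R) : measurable_fun A (EFin \o f).
  by apply/measurable_EFinP; apply: measurable_funTS; exact: continuous_measurable_fun.
have : ((f t / 2)%:E * lambda `[a, b] <= \int[lambda]_(s in `[0%R, 1%R]) (f s)%:E)%E.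
  apply: (@le_trans _ _ (\int[lambda]_(s in `[a, b]) (f s)%:E)%E); last first.
    apply: ge0_subset_integral => //; first exact: mf.
    by move=> s _; rewrite lee_fin.
  rewrite -integral_cst//; apply: ge0_le_integral => //.
  - by move=> s _; rewrite lee_fin ltW// divr_gt0.
  - exact: mf.
  - move=> s; rewrite /= in_itv/= => sab; rewrite lee_fin ltW//; apply: eB.
    by rewrite /ball /= ltr_norml; lra.
rewrite intE lebesgue_measure_itv/= lte_fin ab -EFinB -EFinM lee_fin leNgt.
by rewrite mulr_gt0 ?divr_gt0// subr_gt0.
Qed.

Lemma edge_integral_ge0 (a b : R * R) u : 0 <= edge_integral a b (fun x => u x * u x).
Proof.
apply: mulr_ge0; first exact: sqrtr_ge0.
by apply: Rintegral_ge0 => t _; rewrite -expr2 sqr_ge0.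
Qed.

Lemma ip_Gamma_ge0 u : 0 <= ip u u.
Proof.
by apply: sumr_ge0 => i _; apply: sumr_ge0 => j _; exact: edge_integral_ge0.
Qed.

Hypothesis node_inj : injective p.

(** All edge terms are nonnegative, so each one vanishes; the length factor is nonzero because
    distinct nodes are distinct points. The reduction to [i < j] matches the way the sum counts
    edges. *)
Lemma ip_Gamma_eq0_edge u i j y : V u -> ip u u = 0 -> i != j ->
  interface_edge Omega1 Omega2 i j -> cell [set i; j]%SET y -> u y = 0.
Proof.
move=> Vu uu0; wlog ij : i j / (i < j)%N.
  move=> wl ij; have := ij; rewrite neq_ltn => /orP[ltij|ltji]; first exact: wl.
  move=> [[T Tt ijT] eG] yij; apply: (wl j i) => //.
  - by rewrite eq_sym.
  - split; first by exists T => //; rewrite setUC.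
    by rewrite finset.setUC.
  - by rewrite finset.setUC.
move=> nij eij /(cell2P _ nij)[t t01 <-]; rewrite -/(seg i j t).
have [f cf uE] := trace_continuous nij eij Vu.
rewrite uE//; apply/eqP; rewrite -[_ == 0]orbb -mulf_eq0; apply/eqP.
have cf2 : continuous (fun t => f t * f t).
  by move=> s; apply: cvgM; exact: cf.
apply: (continuous_integral_eq0 cf2) => //; first by move=> s; rewrite -expr2 sqr_ge0.
have /psumr_eq0P/(_ i isT) := uu0; rewrite -/(ip u u) => e0.
have {}e0 : \sum_(j < N | (i < j)%N && `[< interface_edge Omega1 Omega2 i j >])
   edge_integral (p i) (p j) (fun x => u x * u x) = 0.
  by apply: e0 => k _; apply: sumr_ge0 => l _; exact: edge_integral_ge0.
have /psumr_eq0P/(_ j) := e0; rewrite ij asboolT//= => {}e0.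
have /eqP : edge_integral (p i) (p j) (fun x => u x * u x) = 0.
  by apply: e0 => // l _; exact: edge_integral_ge0.
rewrite /edge_integral mulf_eq0 => /orP[|/eqP int0]; last first.
  by rewrite -[RHS]int0; apply: eq_Rintegral => s /set_mem s01; rewrite -/(seg i j s) uE.
rewrite sqrtr_eq0 leNgt => /negP[]; rewrite /dot -!expr2.
rewrite lt_neqAle addr_ge0 ?sqr_ge0// andbT eq_sym paddr_eq0 ?sqr_ge0//.
rewrite !sqrf_eq0 /= !subr_eq0; apply: contra nij => /andP[/eqP h1 /eqP h2].
by apply/eqP/node_inj; move: h1 h2; case: (p i) (p j) => ? ? [? ?] /= -> ->.
Qed.

End InterfaceForm.

(** * Definiteness and dimension of the traces, invariance of the energy under reflection *)

Section Symmetric.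
Context {R : realType}.
Variables (o n : R * R) (Omega Omega1 Omega2 : set (R * R)) (M : mesh R).
Local Notation N := (nb_nodes M).
Local Notation p := (@node R M).
Local Notation fct := (R * R -> R).
Local Notation mu2 := (@lebesgue_measure R \x @lebesgue_measure R)%E.
Local Notation plane := (measurableTypeR R * measurableTypeR R)%type.
Local Notation Gamma := (interface Omega1 Omega2).
Local Notation V := (VGamma M Omega Omega1 Omega2).
Local Notation ip := (ip_Gamma M Omega1 Omega2).
Local Notation rho := (reflection o n).
Implicit Types (u v w : fct) (i j : 'I_N) (x y g h : R * R) (D : set (R * R)).

Hypotheses (n1 : dot n n = 1) (oO : open Omega).
Hypotheses (dec : decomposition Omega Omega1 Omega2).
Hypotheses (mir : mirror_domains o n Omega1 Omega2).
Hypotheses (tri : triangulation Omega M) (cut : cuts_no_element Gamma M).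

(* A trace vanishing on the mesh edges of the interface vanishes on a dense
   subset of the interface. *)
Lemma ip_Gamma_eq0 u : V u -> ip u u = 0 -> u = 0.
Proof.
move=> Vu uu0; have [w [cw wO wT] uE] := Vu.
apply/funext => x; apply: contrapT => ux.
have [Gx|Gx] := pselect (Gamma x); last first.
  by apply: ux; rewrite -uE patchE memNset.
have uG y : Gamma y -> u y = w y by move=> Gy; rewrite -uE patchE mem_set.
have [Ox|Ox] := pselect (Omega x); last by apply: ux; rewrite uG// wO.
have wx : w x != 0 by apply/eqP; rewrite -uG.
have near_w : \forall y \near x, w y != 0.
  exact: (cvgr_neq0 _ (cw x) wx).
have [i [j [y [ij eij yij /eqP]]]] := interface_dense n1 dec mir tri cut oO Ox Gx near_w.
apply; rewrite -uG; last by case: eij => _; apply.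
exact: (ip_Gamma_eq0_edge (node_inj tri) Vu uu0 ij eij yij).
Qed.

Lemma ip_Gamma_scalar_product : scalar_product V ip.
Proof.
split; [exact: ip_Gamma_lin|exact: ip_GammaC|].
move=> u Vu u0; rewrite lt_neqAle ip_Gamma_ge0 andbT eq_sym.
by apply/eqP => /(ip_Gamma_eq0 Vu).
Qed.

(** On each triangle an affine function is the barycentric combination of its vertex values. *)
Lemma W_eq0_nodes w : W M Omega w -> (forall i, w (p i) = 0) -> w = 0.
Proof.
move=> [cw wO wT] wp; apply/funext => x.
have [Ox|Ox] := pselect (Omega x); last exact: wO.
have := subset_closure Ox; have [_ <- _ _] := tri.
move=> [T /= Tt [l [l0 lT l1 xE]]].
have [a [b [c wE]]] := wT _ Tt.
rewrite wE; last by exists l.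
have cellp i : i \in T -> w (p i) = a + b * (p i).1 + c * (p i).2.
  move=> iT; apply: wE; exists (fun k => (k == i)%:R); split.
  - by move=> k; rewrite ler0n.
  - by move=> k kT; case: eqVneq => // ki; rewrite -ki (negPf kT) in iT *.
  - by rewrite (bigD1 i)//= eqxx big1 ?addr0// => k /negPf ->.
  - by rewrite (bigD1 i)//= eqxx scale1r big1 ?addr0// => k /negPf ->; rewrite scale0r.
transitivity (\sum_i l i * (a + b * (p i).1 + c * (p i).2)).
  have fst_sum : (\sum_i l i *: p i).1 = \sum_i l i * (p i).1.
    by elim/big_rec2: _ => //= k y1 y2 _ <-.
  have snd_sum : (\sum_i l i *: p i).2 = \sum_i l i * (p i).2.
    by elim/big_rec2: _ => //= k y1 y2 _ <-.
  have aE : a = \sum_i l i * a by rewrite -mulr_suml l1 mul1r.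
  rewrite xE fst_sum snd_sum {1}aE !mulr_sumr -!big_split/=.
  by apply: eq_bigr => k _; ring.
rewrite big1// => i _; have [iT|/lT ->] := boolP (i \in T); last by rewrite mul0r.
by rewrite -cellp// wp mulr0.
Qed.

(** The nodal values of [N.+1] finite element functions form a matrix with more rows than columns; a
    nonzero vector of its left kernel gives the relation. *)
Lemma VGamma_dimension : dimension_le V N.
Proof.
move=> f Vf.
pose w k := projT1 (cid2 (Vf k)).
have [Ww wf] : (forall k, W M Omega (w k)) /\ forall k, (w k) \_ Gamma = f k.
  by split=> k; rewrite /w; case: cid2.
pose C : 'M[R]_(N.+1, N) := \matrix_(k, i) w k (p i).
have kerC : kermx C != 0.
  by rewrite -mxrank_eq0 mxrank_ker subn_eq0 -ltnNge ltnS rank_leq_col.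
have /rowV0Pn[c cC c0] := kerC.
have {}cC : c *m C = 0 by apply/sub_kermxP.
pose c' k := if insub k is Some i then c 0 i else 0.
have c'E (k : 'I_N.+1) : c' k = c 0 k by rewrite /c' valK.
exists c'; split.
  have [k ck] := rV0Pn _ c0.
  by exists k => //; rewrite c'E.
have W0 : \sum_(k < N.+1) c' k *: w k = 0.
  apply: W_eq0_nodes.
    have sW := W_subspace M Omega.
    by apply: (subspace_sum sW) => k; exact: subspaceZ.
  move=> i; have := congr1 (fun A : 'rV_N => A 0 i) cC.
  rewrite !mxE => <-; rewrite fct_sumE; apply: eq_bigr => k _.
  by rewrite c'E !mxE.
transitivity ((\sum_(k < N.+1) c' k *: w k) \_ Gamma); last first.
  by rewrite W0; apply/funext => x; rewrite patchE; case: ifP.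
apply/funext => x; rewrite patchE; case: ifPn => xG.
  rewrite !fct_sumE; apply: eq_bigr => k _; rewrite !fctE -wf patchE xG//.
rewrite fct_sumE big1// => k _.
by rewrite !fctE -wf patchE (negPf xG) scaler0.
Qed.

Hypothesis mm : mirror_mesh o n M.

Lemma W_reflection w : W M Omega w -> W M Omega (w \o rho).
Proof.
move=> [cw wO wT]; split.
- by move=> x; apply: continuous_comp; [exact: reflection_continuous|exact: cw].
- move=> x Ox /=; apply: wO; move: Ox.
  by rewrite -{1}(Omega_reflection n1 dec mir).
- move=> T /mm[T' Tt' T'E]; have [a [b [c wE]]] := wT _ Tt'.
  (* [k] is the normal derivative of the affine function; reflecting the argument changes the
     coefficients by multiples of it. *)
  pose k := b * n.1 + c * n.2.
  exists (a + 2 * dot o n * k), (b - 2 * k * n.1), (c - 2 * k * n.2) => x Tx.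
  rewrite /= wE; last by rewrite T'E; exists x.
  by rewrite /reflection /k /dot /= /GRing.scale /=; ring.
Qed.

Lemma Wsub_reflection D w : Wsub M Omega D w -> Wsub M Omega (rho @^-1` D) (w \o rho).
Proof.
move=> [w0 Ww0 <-]; exists (w0 \o rho); first exact: W_reflection.
by rewrite closure_reflection//; apply/funext => x; rewrite /= !patchE.
Qed.

(** Linear part of the reflection, which transports gradients and is orthogonal. *)
Let Q g := g - (2 * dot g n) *: n.

Lemma dot_reflected g h : dot (Q g) (Q h) = dot g h.
Proof.
have -> : dot (Q g) (Q h) = dot g h + 4 * dot g n * dot h n * (dot n n - 1).
  by rewrite /Q /dot /= /GRing.scale /=; ring.
by rewrite n1 subrr mulr0 addr0.
Qed.

Lemma locally_affine_reflection u x g : locally_affine u (rho x) g ->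
  locally_affine (u \o rho) x (Q g).
Proof.
move=> ug; have := nbhs_reflection ug; apply: filterS => y /= ->.
congr (_ + _).
by rewrite /Q /reflection /dot /= /GRing.scale /=; ring.
Qed.

(** Both integrands are replaced, off null sets, by the step function [F] and by [F \o rho]. Since
    [F] is measurable, the change of variables applies to it. *)
Lemma aform_reflection D nu u v : mesh_adapted M Omega D ->
  Wsub M Omega D u -> Wsub M Omega D v ->
  aform (rho @^-1` D) nu (u \o rho) (v \o rho) = aform D nu u v.
Proof.
move=> aD Wu Wv.
have [mN N0] := edge_lines_null tri.
have [mrho prho] := @measure_preserving_reflection R o n n1.
pose F (x : plane) : \bar R :=
  (\sum_(T in tris M) (nu * cell_energy D u v T) * \1_(open_cell T) x)%:E.
have FE y : ~ edge_lines M y ->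
    ((fun x => nu * dot (grad u x) (grad v x)) \_ D) y = fine (F y).
  move=> yN; rewrite /F /=; under eq_bigr do rewrite -mulrA.
  rewrite -mulr_sumr -(integrandE tri aD Wu Wv yN) !patchE.
  by case: ifP; rewrite ?mulr0.
have iF : mu2.-integrable setT F := integrable_cells tri _.
have mF : measurable_fun setT F := measurable_int _ iF.
have -> : aform D nu u v = fine (\int[mu2]_x F x)%E.
  rewrite /aform /Rintegral integral_mkcond.
  rewrite (integral_eq_off_null mN N0 (g := F))// => x xN.
  by rewrite restrict_EFin -[RHS]/((fine (F x))%:E); congr (_%:E); exact: FE.
have mN' : measurable (rho @^-1` edge_lines M : set plane).
  by rewrite -[_ @^-1` _]setTI; exact: mrho.
have N0' : mu2 (rho @^-1` edge_lines M) = 0%E by rewrite prho.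
rewrite /aform /Rintegral integral_mkcond.
rewrite (integral_eq_off_null mN' N0' (g := F \o rho)); last first.
  move=> x xN; rewrite restrict_EFin -[RHS]/((fine (F (rho x)))%:E); congr (_%:E).
  rewrite -(FE _ xN) !patchE.
  have -> : (x \in rho @^-1` D) = (rho x \in D) by [].
  case: (boolP (rho x \in D)) => [/set_mem Dx|_]; last by [].
  congr (_ * _).
  have [oD DO adD] := aD.
  have [T Tt Tx] := closure_covered tri (subset_closure (DO _ Dx)) xN.
  have TD : open_cell T `<=` D by apply: adD => //; exists (rho x).
  have [g ug] := Wsub_locally_affine tri Tt TD Wu.
  have [h vh] := Wsub_locally_affine tri Tt TD Wv.
  rewrite (grad_locally_affine (locally_affine_reflection (ug _ Tx))).
  rewrite (grad_locally_affine (locally_affine_reflection (vh _ Tx))).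
  rewrite (grad_locally_affine (ug _ Tx)) (grad_locally_affine (vh _ Tx)).
  exact: dot_reflected.
congr (fine _).
exact: (integral_measure_preserving (measure_preserving_reflection o n1) mF).
Qed.

End Symmetric.

(** * Schur operators *)

Section SchurComplement.
Context {R : realType}.
Variables (o n : R * R) (Omega Omega1 Omega2 : set (R * R)) (M : mesh R).
Local Notation N := (nb_nodes M).
Local Notation fct := (R * R -> R).
Local Notation Gamma := (interface Omega1 Omega2).
Local Notation V := (VGamma M Omega Omega1 Omega2).
Local Notation ip := (ip_Gamma M Omega1 Omega2).
Local Notation rho := (reflection o n).
Local Notation harmonic := (harmonic_extension_spec M Omega Omega1 Omega2).
Local Notation schurM := (schur M Omega Omega1 Omega2).
Implicit Types (u v w e s : fct) (D : set (R * R)) (nu : R).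

Hypotheses (n1 : dot n n = 1) (oO : open Omega).
Hypotheses (dec : decomposition Omega Omega1 Omega2).
Hypotheses (mir : mirror_domains o n Omega1 Omega2).
Hypotheses (tri : triangulation Omega M) (cut : cuts_no_element Gamma M).

Let ipP : scalar_product V ip := ip_Gamma_scalar_product n1 oO dec mir tri cut.
Let sV : subspace V := restriction_subspace M Omega Gamma.

Lemma ip_Gamma_nondegenerate s s' : V s -> V s' ->
  (forall v, V v -> ip s v = ip s' v) -> s = s'.
Proof.
move=> Vs Vs' ss'; apply/eqP; rewrite -subr_eq0; apply/eqP.
have Vd := subspaceB sV Vs Vs'.
have dv v : V v -> ip (s - s') v = 0.
  move=> Vv; rewrite (ipDl ipP)//; last exact: subspaceN.
  by rewrite -scaleN1r (ipZl sV ipP)// ss'// mulN1r subrr.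
by apply: (ip_eq0 ipP) => //; exact: dv.
Qed.

Section Subdomain.
Variable D : set (R * R).
Hypotheses (aD : mesh_adapted M Omega D) (GD : Gamma `<=` boundary D).
Local Notation WD := (Wsub M Omega D).
Local Notation WD0 := (Wsub0 M Omega D).

Let sWD : subspace WD := restriction_subspace M Omega (closure D).

Lemma aform0l nu e : WD e -> aform D nu 0 e = 0.
Proof.
move=> We; have := aform_lin tri nu (-1) aD sWD.1 sWD.1 We.
by rewrite scaler0 addr0 mulN1r addNr.
Qed.

Lemma aformBl nu u v e : WD u -> WD v -> WD e ->
  aform D nu (u - v) e = aform D nu u e - aform D nu v e.
Proof.
move=> Wu Wv We; rewrite -scaleN1r addrC (aform_lin tri nu (-1) aD Wv Wu We).
by rewrite mulN1r addrC.
Qed.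

Lemma aform_Wsub0_eq0 nu z e : 0 <= nu -> WD0 z -> WD e ->
  (forall v, WD0 v -> aform D 1 z v = 0) -> aform D nu z e = 0.
Proof.
move=> nu0 z0 We az; have Wz := z0.1.
by apply: (aform_eq0 tri) => //; rewrite (aform_nu tri nu aD Wz Wz) az// mulr0.
Qed.

Lemma harmonic_nu nu u w : 0 < nu -> harmonic D nu u w <-> harmonic D 1 u w.
Proof.
move=> nu0; split => -[Ww aw wG wB]; split => // v Wv.
  have := aw _ Wv; rewrite (aform_nu tri nu aD Ww Wv.1) => /eqP.
  by rewrite mulf_eq0 gt_eqF//= => /eqP.
by rewrite (aform_nu tri nu aD Ww Wv.1) aw// mulr0.
Qed.

(** The difference of two harmonic extensions vanishes on the boundary and is orthogonal to itself,
    so it has zero energy against every [e]. The choice made in [harmonic_extension] therefore does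
    not affect the Schur operator. *)
Lemma harmonic_aform nu u w w' e : 0 < nu -> harmonic D 1 u w ->
  harmonic D 1 u w' -> WD e -> aform D nu w e = aform D nu w' e.
Proof.
move=> nu0 [Ww aw wG wB] [Ww' aw' wG' wB'] We.
apply/eqP; rewrite -subr_eq0 -(aformBl nu Ww Ww' We); apply/eqP.
apply: (aform_Wsub0_eq0 (ltW nu0) _ We).
  split; first exact: (subspaceB sWD).
  move=> x xB; have [xG|xG] := pselect (Gamma x).
    by rewrite !fctE wG// wG'// subrr.
  by rewrite !fctE wB// wB'// subrr.
by move=> v Wv; rewrite (aformBl 1 Ww Ww' Wv.1) aw// aw'// subrr.
Qed.

Lemma extension_operator_exists : exists E, extension_operator M Omega Omega1 Omega2 D E.
Proof.
exists (fun v => (xget 0 [set w | W M Omega w /\ w \_ Gamma = v]) \_ (closure D)).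
move=> v [w Ww wv].
have /(xgetPex 0) /= [] : [set w | W M Omega w /\ w \_ Gamma = v] !=set0 by exists w.
set w' := xget _ _ => Ww' w'v; split; first by exists w'.
move=> x Gx; rewrite -w'v !patchE !mem_set//; exact: (GD Gx).1.
Qed.

(** An extension operator may be any map, so its value at one trace can be prescribed. This turns a
    statement about all operators into one about all extensions of a given trace. *)
Lemma extension_operator_through v e : V v -> WD e ->
  (forall x, Gamma x -> e x = v x) ->
  exists2 E, extension_operator M Omega Omega1 Omega2 D E & E v = e.
Proof.
move=> Vv We ev; have [E EP] := extension_operator_exists.
exists (fun v' => if pselect (v' = v) then e else E v'); last by case: pselect.
by move=> v' Vv'; case: pselect => [vv|_] /=; [rewrite vv|exact: EP].
Qed.

(* [w] is the discrete harmonic extension of [u], and [s] the image of [u]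
   under the Schur operator, both for the unit coefficient. *)
Definition schur_pair u w s :=
  [/\ harmonic D 1 u w, V s &
    forall v e, V v -> WD e -> (forall x, Gamma x -> e x = v x) ->
      ip s v = aform D 1 w e].

Lemma schur_pair_lin (a : R) u w s u' w' s' : schur_pair u w s ->
  schur_pair u' w' s' -> schur_pair (a *: u + u') (a *: w + w') (a *: s + s').
Proof.
move=> [[Ww aw wG wB] Vs sP] [[Ww' aw' wG' wB'] Vs' sP']; split.
- split; first exact: sWD.2.
  + by move=> v Wv; rewrite (aform_lin tri 1 a aD Ww Ww' Wv.1) aw// aw'// mulr0 addr0.
  + by move=> x Gx; rewrite !fctE wG// wG'.
  + by move=> x Bx; rewrite !fctE wB// wB'// scaler0 addr0.
- exact: sV.2.
- move=> v e Vv We ev.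
  rewrite (aform_lin tri 1 a aD Ww Ww' We).
  case: ipP => ip_lin _ _; rewrite ip_lin//.
  by rewrite (sP _ _ Vv We ev) (sP' _ _ Vv We ev).
Qed.

Lemma schur_pairE nu u w s : 0 < nu -> schur_pair u w s -> schurM D nu u = nu *: s.
Proof.
move=> nu0 [hw Vs sP].
have hw' : harmonic D 1 u (harmonic_extension M Omega Omega1 Omega2 D nu u).
  apply/(harmonic_nu _ _ nu0).
  by apply: (xgetPex 0); exists w; apply/(harmonic_nu _ _ nu0).
have Ww := hw; case: Ww => Ww _ _ _.
have nusP E v : extension_operator M Omega Omega1 Omega2 D E -> V v ->
    ip (nu *: s) v =
    aform D nu (harmonic_extension M Omega Omega1 Omega2 D nu u) (E v).
  move=> EP Vv; have [We ev] := EP _ Vv.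
  rewrite (ipZl sV ipP)// (sP _ _ Vv We ev).
  by rewrite -(aform_nu tri nu aD Ww We); exact: harmonic_aform hw hw' We.
have Vnus : V (nu *: s) by exact: subspaceZ.
have [] : [set s | V s /\ forall E, extension_operator M Omega Omega1 Omega2 D E ->
   forall v, V v -> ip s v =
    aform D nu (harmonic_extension M Omega Omega1 Omega2 D nu u) (E v)] (schurM D nu u).
  by apply: (xgetPex 0); exists (nu *: s); split => // E EP v; exact: nusP.
move=> Vs' s'P; apply: ip_Gamma_nondegenerate => // v Vv.
have [E EP] := extension_operator_exists.
by rewrite (s'P _ EP)// (nusP _ _ EP).
Qed.

Lemma schur_pair0 : schur_pair 0 0 0.
Proof.
split; last 1 first.
- by move=> v e Vv We _; rewrite aform0l// (ip0l sV ipP).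
- split=> //; first exact: sWD.1.
  by move=> v [Wv _]; rewrite aform0l.
exact: sV.1.
Qed.

(* Junk values are 0, so a nonzero value of [schur] certifies that both the
   harmonic extension and the Schur operator are well defined at [u]. *)
Lemma schur_pair_exists u : V u -> schurM D 1 u <> 0 -> exists w s, schur_pair u w s.
Proof.
move=> Vu Su0.
pose H := harmonic_extension M Omega Omega1 Omega2 D 1 u.
have [Vs sP] : [set s | V s /\ forall E, extension_operator M Omega Omega1 Omega2 D E ->
    forall v, V v -> ip s v = aform D 1 H (E v)] (schurM D 1 u).
  apply: (xgetPex 0); apply: contrapT => nex; apply: Su0.
  by apply: xgetPN => s Ps; apply: nex; exists s.
have hH : harmonic D 1 u H.
  apply: (xgetPex 0); apply: contrapT => nex; apply: Su0.
  have H0 : H = 0 by apply: xgetPN => w Pw; apply: nex; exists w.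
  apply: ip_Gamma_nondegenerate => //; first exact: sV.1.
  move=> v Vv; have [E EP] := extension_operator_exists.
  by rewrite (sP _ EP)// H0 aform0l ?(ip0l sV ipP)//; exact: (EP _ Vv).1.
exists H, (schurM D 1 u); split => // v e Vv We ev.
by have [E EP <-] := extension_operator_through Vv We ev; exact: sP.
Qed.

End Subdomain.

Let aD1 : mesh_adapted M Omega Omega1 := mesh_adapted1 dec tri cut.
Let aD2 : mesh_adapted M Omega Omega2 := mesh_adapted2 dec tri cut.
Let GD1 : Gamma `<=` boundary Omega1. Proof. by move=> x []. Qed.
Let GD2 : Gamma `<=` boundary Omega2. Proof. by move=> x []. Qed.

Hypothesis mm : mirror_mesh o n M.

(** Test functions are pulled back by the reflection, which preserves the energy and fixes [Gamma]
    pointwise. The same [s] serves both subdomains: this is [S_1 / nu_1 = S_2 / nu_2]. *)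
Lemma schur_pair_reflection u w s : schur_pair Omega1 u w s ->
  schur_pair Omega2 u (w \o rho) s.
Proof.
have O2 := Omega2E n1 mir; have O1 := Omega1E n1 mir.
have W21 e : Wsub M Omega Omega2 e -> Wsub M Omega Omega1 (e \o rho).
  by move=> We; rewrite O1; exact: (Wsub_reflection n1 dec mir mm).
have rr e : e = (e \o rho) \o rho.
  by apply/funext => x /=; rewrite reflectionK.
have a21 w' e : Wsub M Omega Omega1 w' -> Wsub M Omega Omega2 e ->
    aform Omega2 1 (w' \o rho) e = aform Omega1 1 w' (e \o rho).
  move=> Ww' We; rewrite {1}(rr e) {1}O2.
  exact: (aform_reflection o n1 tri 1 aD1 Ww' (W21 _ We)).
have Grho x : Gamma x -> rho x = x by exact: interface_fixed.
move=> [[Ww aw wG wB] Vs sP]; split => //.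
- split.
  + by rewrite O2; exact: (Wsub_reflection n1 dec mir mm).
  + move=> v [Wv vB]; rewrite a21// aw//; split; first exact: W21.
    move=> x xB /=; apply: vB.
    by rewrite O2 boundary_reflection//= reflectionK.
  + by move=> x Gx /=; rewrite Grho// wG.
  + move=> x [xB xG] /=; apply: wB; split.
      by move: xB; rewrite {1}O2 boundary_reflection.
    by move=> Grx; apply: xG; rewrite -(reflectionK o n1 x) Grho.
- move=> v e Vv We ev; rewrite a21//; apply: sP => //; first exact: W21.
  by move=> x Gx /=; rewrite Grho// ev.
Qed.

Variables (c0 K : R).
Hypotheses (c0_gt0 : 0 < c0).
Hypothesis spS : forall lambda : R, op_eigenvalue V
    (fun u => 1^-1 *: schurM Omega1 1 u) lambda%:C%C -> c0 <= lambda <= K.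

Let S := schurM Omega1 1.

Lemma schur_pair1 u : V u -> exists w, schur_pair Omega1 u w (S u).
Proof.
move=> Vu.
suff [w [s sP]] : exists w s, schur_pair Omega1 u w s.
  by exists w; rewrite /S (schur_pairE aD1 GD1 ltr01 sP) scale1r.
have [->|u0] := pselect (u = 0); first by exists 0, 0; exact: schur_pair0.
apply: schur_pair_exists => // Su0.
(* If the Schur value at a nonzero [u] is 0, then [u] is an eigenvector for 0, which lies below
   [c0]. *)
have : op_eigenvalue V (fun u => 1^-1 *: schurM Omega1 1 u) 0%:C%C.
  exists u, 0; split => //=; first exact: sV.1.
  - by case.
  - by rewrite Su0 !scaler0 scale0r subr0.
  - by rewrite (schur_pairE aD1 GD1 ltr01 (schur_pair0 aD1)) !scaler0 scale0r addr0.
by move=> /spS; rewrite leNgt c0_gt0.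
Qed.

Lemma schur_linear : linear_on V S.
Proof.
split=> [u /schur_pair1[w []]//|a u v Vu Vv].
have [w wP] := schur_pair1 Vu; have [w' wP'] := schur_pair1 Vv.
by rewrite /S (schur_pairE aD1 GD1 ltr01 (schur_pair_lin aD1 a wP wP')) scale1r.
Qed.

(** The harmonic extension of each trace serves as the test extension in the defining relation of
    the other; both products equal the energy of the pair [w], [w']. *)
Lemma schur_self_adjoint : self_adjoint V ip S.
Proof.
move=> u v Vu Vv; rewrite [RHS]ip_GammaC.
have [w [[Ww aw wG wB] _ wP]] := schur_pair1 Vu.
have [w' [[Ww' aw' wG' wB'] _ wP']] := schur_pair1 Vv.
have e1 := wP v w' Vv Ww' wG'; have e2 := wP' u w Vu Ww wG.
exact: (etrans e1 (etrans (aformC Omega1 1 w w') (esym e2))).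
Qed.

Lemma schur1E nu u : 0 < nu -> V u -> schurM Omega1 nu u = nu *: S u.
Proof. by move=> nu0 /schur_pair1[w wP]; exact: schur_pairE wP. Qed.

Lemma schur2E nu u : 0 < nu -> V u -> schurM Omega2 nu u = nu *: S u.
Proof.
move=> nu0 /schur_pair1[w /schur_pair_reflection wP].
exact: (schur_pairE aD2 GD2 nu0 wP).
Qed.

Lemma robin_robin_rate_bound (nu1 nu2 gamma1 gamma2 : R) : 0 <= K ->
  0 < nu1 -> 0 < nu2 -> K * nu2 <= gamma1 -> 0 < gamma2 -> gamma2 <= c0 * nu1 ->
  robin_robin_rate M Omega Omega1 Omega2 nu1 nu2 gamma1 gamma2
    (2 / (2 + nu1 / nu2)) <= nu1 / nu2.
Proof.
move=> K0 nu10 nu20 g1 g20 g2; rewrite /robin_robin_rate /spectral_radius.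
set Z := [set _ | _ in _].
(* Without eigenvalues the supremum takes its default value 0. *)
have [Z0|/set0P/negP/negPn/eqP ->] := pselect (Z !=set0); last first.
  by rewrite sup0 divr_ge0 ?ltW.
apply: ge_sup => // _ [z zP <-].
apply: (@error_operator_eigenvalue_bound _ V ip S _ _ N c0 K nu1 nu2 gamma1 gamma2
  sV (VGamma_dimension tri) ipP schur_linear schur_self_adjoint c0_gt0 _ _ _ nu10 nu20
  g20 K0 _ g2 _ _ erefl zP).
- move=> lambda lP; apply: spS.
  by rewrite (_ : (fun _ => _) = S)//; apply/funext => u; rewrite invr1 scale1r.
- by move=> u Vu; exact: schur1E.
- by move=> u Vu; exact: schur2E.
- by rewrite mulrC.
Qed.

End SchurComplement.

Theorem theorem3p3 (R : realType) (Omega Omega1 Omega2 : set (R * R))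
    (p n : R * R) (I : Type) (M : I -> mesh R) (c0 C1 : R) :
  polygonal_domain Omega ->
  decomposition Omega Omega1 Omega2 ->
  mirror_domains p n Omega1 Omega2 ->
  (forall k, triangulation Omega (M k)) ->
  (forall k, cuts_no_element (interface Omega1 Omega2) (M k)) ->
  (forall k, mirror_mesh p n (M k)) ->
  shape_regular M ->
  quasi_uniform M ->
  0 < c0 ->
  0 < C1 ->
  (forall k (nu1 : R), 0 < nu1 -> forall lambda : R,
     op_eigenvalue (VGamma (M k) Omega Omega1 Omega2)
       (fun u => nu1^-1 *: schur (M k) Omega Omega1 Omega2 Omega1 nu1 u)
       lambda%:C%C ->
     c0 <= lambda <= C1 * (mesh_h (M k))^-1) ->
  exists2 C : R, 0 < C &
    forall k (nu1 nu2 gamma1 gamma2 : R),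
      0 < nu1 -> 0 < nu2 ->
      C1 * nu2 * (mesh_h (M k))^-1 <= gamma1 ->
      0 < gamma2 -> gamma2 <= c0 * nu1 ->
      let theta := 2 / (2 + nu1 / nu2) in
      robin_robin_rate (M k) Omega Omega1 Omega2 nu1 nu2 gamma1 gamma2 theta
        <= C * (nu1 / nu2).
Proof.
move=> [[oO _ _] _ _] dec mir tri cut mm _ _ c0_gt0 C1_gt0 eig.
have n1 : dot n n = 1 by case: mir.
(* The eigenvalue bound is [nu1 / nu2] itself, so the constant is 1. *)
exists 1 => // k nu1 nu2 gamma1 gamma2 nu1_gt0 nu2_gt0 g1 g2_gt0 g2 /=.
rewrite mul1r.
apply: (@robin_robin_rate_bound _ p n Omega Omega1 Omega2 (M k) n1 oO dec mir
  (tri k) (cut k) (mm k) c0 (C1 * (mesh_h (M k))^-1)) => //.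
- exact: (eig k 1 ltr01).
- by rewrite mulr_ge0 ?invr_ge0 ?bigmax_ge_id// ltW.
- by rewrite mulrAC.
Qed.
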